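(* For all integers $m\geq 1$ and $n\in\mathbb{Z}$, under the identification of $F$ with $\Lambda\otimes\mathbb{C}$ sending each maya diagram $\lambda$ to the Schur function $s_\lambda$, one has $$\phi^{(m)}_{-n}=\sum_{i\ge 0}(-1)^i\,(h_{n+i}\circ p_m)\,(e_i\circ p_m)^{\perp},$$ where $f\circ p_m$ denotes the plethysm with the $m$-th power sum, $(f\circ p_m)(X_1,X_2,\ldots)=f(X_1^m,X_2^m,\ldots)$.
   Context: A maya diagram is a sequence of integers $[x_1,x_2,\ldots]$ with $x_1>x_2>\cdots$ and $x_i=-i$ for all sufficiently large $i$. Maya diagrams correspond bijectively to partitions: $\lambda=(\lambda_1,\ldots,\lambda_l)$ (extended by infinitely many zeros) corresponds to $[\lambda_1-1,\lambda_2-2,\lambda_3-3,\ldots]$; the same symbol is used for both. A charged maya diagram is a strictly decreasing integer sequence $[x_1,x_2,\ldots]$ with $x_{i+1}=x_i-1$ for all sufficiently large $i$. Let $F$ (resp. $\tilde F$) be the $\mathbb{C}$-vector space with basis the set of all maya diagrams (resp. charged maya diagrams). A sequence satisfying the condition at large $i$ but not necessarily decreasing is regarded as an element of $F$ (resp. $\tilde F$) by the rule $[\ldots,i,\ldots,j,\ldots]+[\ldots,j,\ldots,i,\ldots]=0$ (swapping two entries changes the sign; sequences with a repeated entry are zero). For integers $m\ge1$ and $k$, the linear operator $\phi^{(m)}_k:F\to F$ is defined on maya diagrams by $$\phi^{(m)}_k([x_1,x_2,\ldots])=\Bigl(\sum_{a_0,\ldots,a_{m-1}}[a_{m-1},a_{m-2},\ldots,a_0,x_1,x_2,\ldots]\Bigr)-m,$$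 where the sum is over all $m$-tuples of integers $(a_0,\ldots,a_{m-1})$ with $a_i\equiv i\pmod m$ and $a_0+\cdots+a_{m-1}=(0+1+\cdots+(m-1))-km$ (only finitely many terms are nonzero), and ''$-m$'' denotes the linear operator $[y_1,y_2,\ldots]\mapsto[y_1-m,y_2-m,\ldots]$. $\Lambda$ is the ring of symmetric functions over $\mathbb{Z}$ in variables $X_1,X_2,\ldots$; $h_r$, $e_r$, $p_r$ are the complete, elementary and power-sum symmetric functions, with $h_0=e_0=1$ and $h_r=e_r=0$ for $r<0$; $s_\lambda$ is the Schur function of the partition corresponding to $\lambda$. The Hall inner product on $\Lambda$ is given by $\langle s_\lambda,s_\mu\rangle=\delta_{\lambda\mu}$; $f^\perp$ is the adjoint of multiplication by $f$: $\langle f^\perp(g),h\rangle=\langle g,fh\rangle$; operators are extended $\mathbb{C}$-linearly to $\Lambda\otimes\mathbb{C}$. In the formula, $h_{n+i}\circ p_m$ denotes the operator of multiplication by that symmetric function; the infinite sum has only finitely many nonzero terms when applied to any given element. *)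

(* Defs.v *)
From HB Require Import structures.
From mathcomp Require Import all_boot all_order all_fingroup all_algebra.
From mathcomp Require Import boolp classical_sets fsbigop reals.
From mathcomp.real_closed Require Import complex.
From mathcomp Require Import freeg mpoly.

Set Implicit Arguments.
Unset Strict Implicit.
Unset Printing Implicit Defensive.

Import GRing.Theory Num.Theory.
Local Open Scope classical_set_scope.
Local Open Scope ring_scope.

(** * Symmetric functions *)

(* The ring of symmetric functions is the graded inverse limit of the rings of
   symmetric polynomials: an element is a family f_n(X_1, ..., X_n), n >= 0, of
   symmetric polynomials of bounded degree, such that
   f_(n+1)(X_1, ..., X_n, 0) = f_n(X_1, ..., X_n). *)

Definition kill_last (A : comNzRingType) (n : nat) (p : {mpoly A[n.+1]}) :
    {mpoly A[n]} :=
  p \mPo [tuple oapp (fun j : 'I_n => 'X_j) 0 (unlift ord_max i) | i < n.+1].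

Definition is_symfun (A : comNzRingType) (f : forall n, {mpoly A[n]}) : Prop :=
  [/\ forall n, f n \is symmetric,
      forall n, kill_last (f n.+1) = f n
    & exists d, forall n, (msize (f n) <= d)%N].

Record symfun (A : comNzRingType) := SymFun {
  symfun_val :> forall n, {mpoly A[n]};
  symfunP : is_symfun symfun_val }.

HB.instance Definition _ (A : comNzRingType) := gen_eqMixin (symfun A).
HB.instance Definition _ (A : comNzRingType) := gen_choiceMixin (symfun A).

Section SymFunRing.
Variable A : comNzRingType.
Implicit Types f g h : symfun A.

Lemma symfun_eqP f g : (forall n, f n = g n) -> f = g.
Proof.
case: f g => [f fP] [g gP] /= fg.
have {fg} fg : f = g by exact: functional_extensionality_dep.
by case: g / fg gP => gP; congr SymFun; exact: Prop_irrelevance.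
Qed.

Fact symfun_zero_subproof : is_symfun (fun n => 0 : {mpoly A[n]}).
Proof.
split=> [n|n|]; [exact: rpred0 | by rewrite /kill_last raddf0 |].
by exists 0%N => n; rewrite msize0.
Qed.

Fact symfun_one_subproof : is_symfun (fun n => 1 : {mpoly A[n]}).
Proof.
split=> [n|n|]; [exact: rpred1 | by rewrite /kill_last rmorph1 |].
by exists 1%N => n; rewrite msize1.
Qed.

Fact symfun_opp_subproof f : is_symfun (fun n => - f n).
Proof.
case: (symfunP f) => sf rf [d df]; split=> [n|n|]; first by rewrite rpredN sf.
  by rewrite -[in RHS]rf /kill_last raddfN.
by exists d => n; rewrite msizeN.
Qed.

Fact symfun_add_subproof f g : is_symfun (fun n => f n + g n).
Proof.
case: (symfunP f) (symfunP g) => sf rf [d df] [sg rg [e eg]].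
split=> [n|n|]; first by rewrite rpredD ?sf ?sg.
  by rewrite -[in RHS]rf -[in RHS]rg /kill_last raddfD.
exists (maxn d e) => n; apply: leq_trans (msizeD_le _ _) _.
by rewrite geq_max !leq_max df eg orbT.
Qed.

Fact symfun_scale_subproof (a : A) f : is_symfun (fun n => a *: f n).
Proof.
case: (symfunP f) => sf rf [d df]; split=> [n|n|]; first by rewrite rpredZ ?sf.
  by rewrite -[in RHS]rf /kill_last linearZ.
by exists d => n; apply: leq_trans (msizeZ_le _ _) _.
Qed.

Fact symfun_mul_subproof f g : is_symfun (fun n => f n * g n).
Proof.
case: (symfunP f) (symfunP g) => sf rf [d df] [sg rg [e eg]].
split=> [n|n|]; first by rewrite rpredM ?sf ?sg.
  by rewrite -[in RHS]rf -[in RHS]rg /kill_last rmorphM.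
exists (d + e).+1 => n; apply: leq_trans (msizeM_le _ _) _.
by rewrite ltnS leq_add.
Qed.

Definition symfun_zero := SymFun symfun_zero_subproof.
Definition symfun_one := SymFun symfun_one_subproof.
Definition symfun_opp f := SymFun (symfun_opp_subproof f).
Definition symfun_add f g := SymFun (symfun_add_subproof f g).
Definition symfun_scale a f := SymFun (symfun_scale_subproof a f).
Definition symfun_mul f g := SymFun (symfun_mul_subproof f g).

Fact symfun_addA : associative symfun_add.
Proof. by move=> f g h; apply: symfun_eqP => n /=; rewrite addrA. Qed.
Fact symfun_addC : commutative symfun_add.
Proof. by move=> f g; apply: symfun_eqP => n /=; rewrite addrC. Qed.
Fact symfun_add0 : left_id symfun_zero symfun_add.
Proof. by move=> f; apply: symfun_eqP => n /=; rewrite add0r. Qed.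
Fact symfun_addN : left_inverse symfun_zero symfun_opp symfun_add.
Proof. by move=> f; apply: symfun_eqP => n /=; rewrite addNr. Qed.

HB.instance Definition _ := GRing.isZmodule.Build (symfun A)
  symfun_addA symfun_addC symfun_add0 symfun_addN.

Fact symfun_mulA : associative symfun_mul.
Proof. by move=> f g h; apply: symfun_eqP => n /=; rewrite mulrA. Qed.
Fact symfun_mulC : commutative symfun_mul.
Proof. by move=> f g; apply: symfun_eqP => n /=; rewrite mulrC. Qed.
Fact symfun_mul1 : left_id symfun_one symfun_mul.
Proof. by move=> f; apply: symfun_eqP => n /=; rewrite mul1r. Qed.
Fact symfun_mulD : left_distributive symfun_mul +%R.
Proof. by move=> f g h; apply: symfun_eqP => n /=; rewrite mulrDl. Qed.
Fact symfun_one_neq0 : symfun_one != 0.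
Proof.
by apply/eqP => /(congr1 (fun f : symfun A => f 0%N)) /eqP; rewrite oner_eq0.
Qed.

HB.instance Definition _ := GRing.Zmodule_isComNzRing.Build (symfun A)
  symfun_mulA symfun_mulC symfun_mul1 symfun_mulD symfun_one_neq0.

Fact symfun_scaleA a b f :
  symfun_scale a (symfun_scale b f) = symfun_scale (a * b) f.
Proof. by apply: symfun_eqP => n /=; rewrite scalerA. Qed.
Fact symfun_scale1 : left_id 1 symfun_scale.
Proof. by move=> f; apply: symfun_eqP => n /=; rewrite scale1r. Qed.
Fact symfun_scaleDr : right_distributive symfun_scale +%R.
Proof. by move=> a f g; apply: symfun_eqP => n /=; rewrite scalerDr. Qed.
Fact symfun_scaleDl f : {morph symfun_scale^~ f : a b / a + b}.
Proof. by move=> a b; apply: symfun_eqP => n /=; rewrite scalerDl. Qed.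

HB.instance Definition _ := GRing.Zmodule_isLmodule.Build A (symfun A)
  symfun_scaleA symfun_scale1 symfun_scaleDr symfun_scaleDl.

Fact symfun_scaleAl a f g : a *: (f * g) = (a *: f) * g.
Proof. by apply: symfun_eqP => n /=; rewrite scalerAl. Qed.

HB.instance Definition _ := GRing.Lmodule_isLalgebra.Build A (symfun A)
  symfun_scaleAl.
HB.instance Definition _ := GRing.Lalgebra_isComAlgebra.Build A (symfun A).

End SymFunRing.

(** * Elementary and complete symmetric functions, plethysm with p_m *)

Lemma widen_lift n (j : 'I_n) :
  widen_ord (leqnSn n) j = fintype.lift ord_max j.
Proof. by apply: val_inj => /=; rewrite /bump leqNgt ltn_ord. Qed.

Lemma mcoeff_kill_last (A : comNzRingType) n (p : {mpoly A[n.+1]}) mu :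
  (kill_last p)@_mu = p@_(mnmwiden mu).
Proof.
rewrite /kill_last comp_mpolyEX [in RHS](mpolyE p) !raddf_sum /=.
apply: eq_bigr => k _; rewrite !mcoeffZ; congr (_ * _).
rewrite comp_mpolyX big_ord_recr /= tnth_mktuple unlift_none /= expr0n.
rewrite mcoeffX; case: eqVneq => [k0|kn0] /=; last first.
  rewrite mulr0 mcoeff0; case: eqVneq => // kE.
  by rewrite kE mnmwiden_ordmax eqxx in kn0.
rewrite mulr1 (eq_bigr (fun i : 'I_n => 'X_i ^+ k (widen_ord (leqnSn n) i))).
  rewrite (_ : \prod_i _ =
    'X_[[multinom k (widen_ord (leqnSn n) i) | i < n]]); last first.
    by rewrite [RHS]mpolyXE_id; apply: eq_bigr => i _; rewrite mnmE.
  rewrite mcoeffX; congr (nat_of_bool _)%:R; apply/eqP/eqP => [<-|->].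
    apply/mnmP => i; case: (unliftP ord_max i) => [j|] -> /=.
      by rewrite -widen_lift mnmwiden_widen mnmE.
    by rewrite mnmwiden_ordmax.
  by apply/mnmP => i; rewrite mnmE mnmwiden_widen.
move=> i _; rewrite tnth_mktuple.
by rewrite widen_lift liftK.
Qed.

Lemma mdeg_mnmwiden n (mu : 'X_{1..n}) : mdeg (mnmwiden mu) = mdeg mu.
Proof.
rewrite !mdegE big_ord_recr /= mnmwiden_ordmax addn0.
by apply: eq_bigr => i _; rewrite mnmwiden_widen.
Qed.

Lemma mcoeff_mcomplete (A : comNzRingType) n k (mu : 'X_{1..n}) :
  (\sum_(nu : 'X_{1..n < k.+1} | mdeg nu == k) 'X_[nu] : {mpoly A[n]})@_mu
    = (mdeg mu == k)%:R.
Proof.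
rewrite raddf_sum /=; case: eqVneq => [dmu|dmu]; last first.
  rewrite big1 // => nu /eqP dnu; rewrite mcoeffX; case: eqVneq => // nuE.
  by rewrite -nuE dnu eqxx in dmu.
have lt_mu : (mdeg mu < k.+1)%N by rewrite dmu.
rewrite (bigD1 (BMultinom lt_mu)) /= ?dmu // mcoeffX eqxx big1 ?addr0 //.
move=> nu /andP[_ nuE]; rewrite mcoeffX; case: eqVneq => // nu_mu.
by case/eqP: nuE; apply: val_inj.
Qed.

Fact sf_h_subproof (A : comNzRingType) (k : nat) :
  is_symfun (fun n =>
    \sum_(mu : 'X_{1..n < k.+1} | mdeg mu == k) 'X_[mu] : {mpoly A[n]}).
Proof.
split=> [n|n|].
- apply/issymP => s; apply/mpolyP => mu.
  by rewrite mcoeff_sym !mcoeff_mcomplete mdeg_mperm.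
- by apply/mpolyP => mu; rewrite mcoeff_kill_last !mcoeff_mcomplete mdeg_mnmwiden.
exists k.+1 => n; apply: leq_trans (msize_sum _ _ _) _.
by apply/bigmax_leqP_seq => mu _ /eqP dmu; rewrite msizeX dmu.
Qed.

(* h_r, with h_r = 0 for r < 0. *)
Definition sf_h (A : comNzRingType) (r : int) : symfun A :=
  if r is Posz k then SymFun (sf_h_subproof A k) else 0.

Fact sf_e_subproof (A : comNzRingType) (k : nat) :
  is_symfun (fun n => mesym n A k).
Proof.
split=> [n|n|]; first exact: mesym_sym.
  apply/mpolyP => mu; rewrite mcoeff_kill_last !mcoeff_mesym /mechar.
  rewrite mdeg_mnmwiden; congr (nat_of_bool (_ && _))%:R.
  apply/forallP/forallP => [le1 i|le1 i].
    by have := le1 (widen_ord (leqnSn n) i); rewrite mnmwiden_widen.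
  case: (unliftP ord_max i) => [j|] -> /=; last by rewrite mnmwiden_ordmax.
  by rewrite -widen_lift mnmwiden_widen.
exists k.+1 => n; rewrite mesymE; apply: leq_trans (msize_sum _ _ _) _.
by apply/bigmax_leqP_seq => h _ /eqP dh; rewrite msizeX mdeg_mesym1 dh.
Qed.

Definition sf_e (A : comNzRingType) (k : nat) : symfun A :=
  SymFun (sf_e_subproof A k).

Definition mpleth (A : comNzRingType) (m n : nat) (p : {mpoly A[n]}) :
    {mpoly A[n]} :=
  p \mPo [tuple 'X_i ^+ m | i < n].

Lemma mplethX (A : comNzRingType) m n (k : 'X_{1..n}) :
  mpleth m ('X_[k] : {mpoly A[n]}) = 'X_[(k *+ m)%MM].
Proof.
rewrite /mpleth comp_mpolyX [RHS]mpolyXE_id; apply: eq_bigr => i _.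
by rewrite tnth_mktuple mulmnE exprAC exprM.
Qed.

Lemma mplethE (A : comNzRingType) m n (p : {mpoly A[n]}) :
  mpleth m p = \sum_(k <- msupp p) p@_k *: 'X_[(k *+ m)%MM].
Proof.
rewrite [in LHS](mpolyE p) /mpleth raddf_sum; apply: eq_bigr => k _.
by rewrite /= comp_mpolyZ -/(mpleth _ _) mplethX.
Qed.

Lemma kill_last_mpleth (A : comNzRingType) m n (p : {mpoly A[n.+1]}) :
  (0 < m)%N -> kill_last (mpleth m p) = mpleth m (kill_last p).
Proof.
move=> m_gt0; rewrite mplethE.
have -> : kill_last p = \sum_(k <- msupp p) p@_k *: kill_last 'X_[k].
  rewrite [in LHS](mpolyE p) /kill_last raddf_sum; apply: eq_bigr => k _.
  by rewrite /= comp_mpolyZ.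
rewrite /mpleth {1}/kill_last !raddf_sum.
apply: eq_bigr => k _; rewrite /kill_last /= !comp_mpolyZ !comp_mpolyX rmorph_prod /=.
congr (_ *: _); apply: eq_bigr => i _; rewrite rmorphXn /= mulmnE mulnC exprM.
congr (_ ^+ _); rewrite !tnth_mktuple; case: unliftP => [j|] _ /=.
  by rewrite comp_mpolyXU -tnth_nth tnth_mktuple.
by rewrite raddf0 expr0n; case: (m) m_gt0.
Qed.

Fact pleth_p_subproof (A : comNzRingType) (m : nat) (m_gt0 : (0 < m)%N)
  (f : symfun A) : is_symfun (fun n => mpleth m (f n)).
Proof.
case: (symfunP f) => sf rf [d df]; split=> [n|n|].
- apply/issymP => s; rewrite -[in RHS](issymP _ (sf n) s).
  have -> : msym s (f n) = \sum_(k <- msupp (f n)) (f n)@_k *: msym s 'X_[k].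
    rewrite [in LHS](mpolyE (f n)) raddf_sum; apply: eq_bigr => k _.
    by rewrite /= msymZ.
  rewrite mplethE /mpleth !raddf_sum.
  apply: eq_bigr => k _; rewrite /= msymZ comp_mpolyZ !msymX -/(mpleth _ _) mplethX.
  by congr (_ *: 'X_[_]); apply/mnmP => i; rewrite !(mnmE, mulmnE).
- by rewrite kill_last_mpleth // rf.
exists (d * m).+1 => n; rewrite mplethE; apply: leq_trans (msize_sum _ _ _) _.
apply/bigmax_leqP_seq => k kf _; apply: leq_trans (msizeZ_le _ _) _.
rewrite msizeX ltnS mdegMn leq_mul2r; apply/orP; right.
exact: ltnW (leq_trans (msize_mdeg_lt kf) (df n)).
Qed.

(* f o p_m, i.e. f(X_1^m, X_2^m, ...); compatibility with X_(n+1) = 0 requires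
   m > 0. *)
Definition pleth_p (A : comNzRingType) (m : nat) (m_gt0 : (0 < m)%N)
  (f : symfun A) : symfun A := SymFun (pleth_p_subproof m_gt0 f).

(** * Schur functions *)

(* The alternant det(X_j^(k_i)). *)
Definition alternant (A : comNzRingType) (n : nat) (k : nat -> nat) :
  {mpoly A[n]} := \det (\matrix_(i < n, j < n) 'X_j ^+ k i).

(* Here la i is the part la_(i+1). s_la is the symmetric function equal, in n
   variables, to the quotient of alternants a_(la+delta) / a_delta with
   delta = (n-1, ..., 1, 0), for all n at least the length of la. *)
Definition schur (A : comNzRingType) (la : nat -> nat) : symfun A :=
  xget 0 [set f : symfun A | forall n, (forall i, (n <= i)%N -> la i = 0%N) ->
    f n * alternant A n (fun i => n - i.+1)%N =
      alternant A n (fun i => la i + (n - i.+1))%N].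

(** * Maya diagrams *)

(* Sequences are indexed from 0: x i is the entry x_(i+1). A charged maya diagram
   satisfies x_i = c - i for i large, for a unique integer c, its charge; the maya
   diagrams are those of charge 0. *)
Definition is_maya (c : int) (x : nat -> int) : Prop :=
  (forall i, x i.+1 < x i) /\
  exists N : nat, forall i, (N <= i)%N -> x i = c - i.+1%:Z.

Record maya (c : int) := Maya {
  maya_val :> nat -> int;
  mayaP : is_maya c maya_val }.

HB.instance Definition _ (c : int) := gen_eqMixin (maya c).
HB.instance Definition _ (c : int) := gen_choiceMixin (maya c).

(* la_i = x_i + i >= 0 *)
Definition maya_part (x : maya 0) (i : nat) : nat := `|(x i + i.+1%:Z)%R|%N.

(* fock A c is spanned by the maya diagrams of charge c; so F = fock A 0, and the
   space on all charged maya diagrams is the direct sum of the fock A c. *)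
Definition fock (A : comNzRingType) (c : int) := {freeg (maya c) / A}.

(* The vector denoted by a sequence with x_i = c - i for i large. It is sgn(s) y if
   x is obtained from the maya diagram y by a permutation s of its first n
   entries; there is no such y exactly when x has a repeated entry. *)
Definition wedge (A : comNzRingType) (c : int) (x : nat -> int) : fock A c :=
  xget 0 [set v : fock A c | exists (y : maya c) (n : nat) (s : 'S_n),
    [/\ forall i : 'I_n, x i = y (s i),
        forall i, (n <= i)%N -> x i = y i
      & v = (-1) ^+ s *: << y >>]].

Fact maya_shift_subproof (m : nat) (y : maya m%:Z) :
  is_maya 0 (fun i => y i - m%:Z).
Proof.
case: (mayaP y) => dec_y [N yN]; split=> [i|]; first by rewrite ltrD2r.
by exists N => i /yN ->; rewrite addrAC subrr.
Qed.

Definition maya_shift (m : nat) (y : maya m%:Z) : maya 0 :=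
  Maya (maya_shift_subproof y).

(* The operator "- m"; [a_(m-1), ..., a_0, x_1, ...] has charge m. *)
Definition fock_shift (A : comNzRingType) (m : nat) :
  fock A m%:Z -> fock A 0 := fglift (fun y => << maya_shift y >>).

(* The sequence [a_(m-1), ..., a_0, x_1, x_2, ...]. *)
Definition prepend (m : nat) (a : {ffun 'I_m -> int}) (x : nat -> int) :
    nat -> int :=
  fun i => if insub i is Some j then a (rev_ord j) else x (i - m)%N.

(* For fixed x only finitely many of the summands are nonzero, so \sum_(a \in _) is
   the intended sum. *)
Definition phi (A : comNzRingType) (m : nat) (k : int) : fock A 0 -> fock A 0 :=
  fglift (fun x : maya 0 => fock_shift
    (\sum_(a \in [set a : {ffun 'I_m -> int} |
         (forall i, (a i = i%:Z %[mod m%:Z])%Z) /\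
         \sum_i a i = (\sum_(i < m) i%:Z) - k * m%:Z])
       wedge A m%:Z (prepend a x))).

(** * The Hall inner product *)

Definition schur_maya (A : comNzRingType) (x : maya 0) : symfun A :=
  schur A (maya_part x).

Definition fock_to_sym (A : comNzRingType) : fock A 0 -> symfun A :=
  fglift (@schur_maya A).

(* The bilinear form for which the Schur functions are orthonormal. *)
Definition hall (A : comNzRingType) : symfun A -> symfun A -> A :=
  xget (fun _ _ => 0) [set B : symfun A -> symfun A -> A |
    [/\ forall f, scalar (B f), forall g, scalar (B^~ g)
      & forall x y, B (schur_maya A x) (schur_maya A y) = (x == y)%:R]].

(* f^perp, the adjoint of the multiplication by f. *)
Definition perp (A : comNzRingType) (f : symfun A) : symfun A -> symfun A :=
  xget (fun=> 0) [set D : symfun A -> symfun A |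
    forall g h, hall (D g) h = hall g (f * h)].

(* Main.v *)
Require Import Defs.
From HB Require Import structures.
From mathcomp Require Import all_boot all_order all_fingroup all_algebra.
From mathcomp Require Import boolp classical_sets functions fsbigop reals.
From mathcomp.real_closed Require Import complex.
From mathcomp Require Import freeg mpoly.
From mathcomp Require Import zify.

Set Implicit Arguments.
Unset Strict Implicit.
Unset Printing Implicit Defensive.

Import GRing.Theory Num.Theory Order.TTheory.
Local Open Scope classical_set_scope.
Local Open Scope ring_scope.

(** Write T_j for the operation that raises the entry in position j of a
    sequence by m.  Expanding a symmetric polynomial f in the T_j and letting it
    act on the wedge of a sequence is multiplication by f o p_m on Schur
    functions; using the inverse operations instead gives the adjoint of that
    multiplication.  Both facts are read off in finitely many variables from the
    bialternant formula s_la * a_delta = a_(la + delta): a symmetric polynomial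
    times an alternant is the sum of the alternants with displaced exponents
    ([mul_wedge_sym]), and the matrix coefficients of the two actions agree up to
    inverting the sorting permutation ([schur_coef_mul_lower], [perp_schur]).

    Count positions from 1 and let x be a maya diagram with x_j = -j for all
    j > N.  If entries beyond N are lowered, the last of them repeats a later
    entry, so only the first N positions enter the elementary functions;
    antisymmetric cancellation shows that only the first N + m positions enter the
    complete ones ([mul_h_wedge_sym]).  The right-hand side of the theorem is thus
    the coefficient of t^n in
      prod_(j <= N) (1 - t^-1 T_j^-1) * prod_(j <= N + m) (1 - t T_j)^-1,
    and since 1 - t^-1 T^-1 = - t^-1 T^-1 (1 - t T), the factors at j <= N
    collapse: every one of the first N entries is lowered by m, a sign (-1)^N
    appears, and h_(n+N) acts on positions N + 1, ..., N + m of the vacuum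
    ([sum_h_perp_e_schur]).

    On the left-hand side, after the shift by m, the m prepended entries have the
    residues of the first m vacuum entries modulo m, so they are the vacuum entries in positions
    1, ..., m displaced by integer multiples of m whose sum is fixed.
    Transposing positions j and j + m for j = 1, ..., N in turn carries this block
    of m free entries past the entries of x, keeps its residue pattern, raises the
    total displacement by 1 and contributes a sign -1 each time
    ([slot_sum_rotN]).  At the end the block occupies positions
    N + 1, ..., N + m, where a negative displacement repeats a vacuum entry, and
    the two sides coincide ([slot_sum_tail]).  The general vector follows by
    linearity. *)

(** * Alternants with integer exponents *)

Section Alternants.
Variable A : numDomainType.
Implicit Types (M : nat) (z : nat -> int).

(** Negative exponents give a zero row: lowering an entry of a sequence below the
    vacuum level then needs no case distinction, because the corresponding wedge
    vanishes as well. *)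
Definition zalternant M (z : nat -> int) : {mpoly A[M]} :=
  \det (\matrix_(i < M, j < M) if z i is Posz k then 'X_j ^+ k else 0).

(** This permutation expansion is the working form of the alternant: it also
    covers the case of a negative exponent, for which all summands vanish. *)
Lemma mcoeff_zalternant M z mu :
  (zalternant M z)@_mu =
    \sum_(s : 'S_M) (-1) ^+ s * [forall i, (mu (s i))%:Z == z i]%:R.
Proof.
rewrite /zalternant /determinant raddf_sum /=; apply: eq_bigr => s _.
have -> (p : {mpoly A[M]}) : ((-1) ^+ s * p)@_mu = (-1) ^+ s * p@_mu.
  by case: (odd_perm s); rewrite ?(expr1, expr0) ?mulN1r ?mul1r // mcoeffN.
congr (_ * _); under eq_bigr do rewrite mxE.
have [z_ge0|] := pselect (forall i : 'I_M, 0 <= z i).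
  have zE (i : 'I_M) : z i = Posz `|z i|%N by rewrite gez0_abs.
  pose k := [multinom `|z ((s^-1)%g i)|%N | i < M].
  have -> : \prod_(i < M) (if z i is Posz k then 'X_(s i) ^+ k else 0)
      = 'X_[k] :> {mpoly A[M]}.
    rewrite (mpolyXE _ s); apply: eq_bigr => i _.
    by rewrite zE mnmE permK.
  rewrite mcoeffX; congr (nat_of_bool _)%:R; apply/eqP/forallP => [<- i|mu_z].
    by rewrite mnmE permK -zE.
  apply/mnmP => i; rewrite mnmE; have /eqP := mu_z ((s^-1)%g i).
  by rewrite permKV => <-.
move=> /existsNP[i zi_lt0]; rewrite (bigD1 i) //=.
case zi: (z i) zi_lt0 => [k|k] // _; rewrite mul0r mcoeff0.
by case: forallP => // /(_ i); rewrite zi.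
Qed.

Lemma eq_zalternant M z z' :
  (forall i, (i < M)%N -> z i = z' i) -> zalternant M z = zalternant M z'.
Proof.
by move=> zz'; congr (\det _); apply/matrixP => i j; rewrite !mxE zz'.
Qed.

Lemma zalternant_perm M (s : 'S_M) z z' :
  (forall i : 'I_M, z' i = z (s i)) -> zalternant M z' = (-1) ^+ s *: zalternant M z.
Proof.
move=> zz'; rewrite /zalternant.
have -> : (\matrix_(i < M, j < M) if z' i is Posz k then 'X_j ^+ k else 0) =
   row_perm s (\matrix_(i < M, j < M) if z i is Posz k then 'X_j ^+ k else 0)
   :> 'M[{mpoly A[M]}]_M.
  by apply/matrixP => i j; rewrite !mxE zz'.
rewrite row_permE det_mulmx det_perm; case: (odd_perm s).
  by rewrite expr1 mulN1r scaleN1r.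
by rewrite expr0 mul1r scale1r.
Qed.

Lemma zalternant_repeat M z (i j : nat) :
  (i < M)%N -> (j < M)%N -> i <> j -> z i = z j -> zalternant M z = 0.
Proof.
move=> iM jM ij zij.
apply: (@determinant_alternate _ _ _ (Ordinal iM) (Ordinal jM)).
  by apply/eqP => /(congr1 val).
by move=> k; rewrite !mxE zij.
Qed.

Lemma zalternant_neg M z i : (i < M)%N -> z i < 0 -> zalternant M z = 0.
Proof.
move=> iM zi; apply/mpolyP => mu; rewrite mcoeff_zalternant mcoeff0 big1 // => s _.
case: forallP => [/(_ (Ordinal iM)) /eqP /= zE|_]; last by rewrite mulr0.
by rewrite -zE in zi.
Qed.

(** The antisymmetrisation of one monomial; multiplication by a symmetric
    polynomial commutes with it. *)
Lemma zalternant_sum_msym M z :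
  (forall i, (i < M)%N -> 0 <= z i) ->
  zalternant M z = \sum_(s : 'S_M) (-1) ^+ s *: msym s 'X_[[multinom `|z i|%N | i < M]].
Proof.
move=> z_ge0; apply/mpolyP => mu; rewrite mcoeff_zalternant raddf_sum /=.
apply: eq_bigr => s _; rewrite mcoeffZ mcoeff_sym mcoeffX; congr (_ * _%:R).
congr nat_of_bool; apply/forallP/eqP => [muE|/mnmP muE i].
  by apply/mnmP => i; rewrite !mnmE; have /eqP := muE i => <-.
by have := muE i; rewrite !mnmE => <-; rewrite gez0_abs ?z_ge0.
Qed.

(** The alternant a_delta, the denominator of the bialternant formula. *)
Definition vandermonde M : {mpoly A[M]} := alternant A M (fun i => M - i.+1)%N.

Lemma alternantE M k : alternant A M k = zalternant M (fun i => (k i)%:Z).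
Proof. by []. Qed.

Lemma eq_alternant M k k' :
  (forall i, (i < M)%N -> k i = k' i) -> alternant A M k = alternant A M k'.
Proof.
by move=> kk'; rewrite !alternantE; apply: eq_zalternant => i iM; rewrite kk'.
Qed.

(** A permutation relating two strictly decreasing sequences must be the
    identity, so the coefficients of alternants at decreasing exponents separate
    them. *)
Lemma mcoeff_zalternant_sorted M z z' :
  (forall i j, (i < j < M)%N -> z j < z i) ->
  (forall i j, (i < j < M)%N -> z' j < z' i) ->
  (forall i, (i < M)%N -> 0 <= z' i) ->
  (zalternant M z)@_[multinom `|z' i|%N | i < M] =
    [forall i : 'I_M, z' i == z i]%:R.
Proof.
move=> dec_z dec_z' z'_ge0; rewrite mcoeff_zalternant (bigD1 1%g) //=.
rewrite odd_perm1 expr0 mul1r big1 ?addr0.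
  congr (nat_of_bool _)%:R; apply: eq_forallb => i.
  by rewrite mnmE perm1 gez0_abs ?z'_ge0.
(* A strictly increasing permutation satisfies both i <= s i and s i <= i. *)
move=> s s_neq1; case: forallP => [zE|_]; last by rewrite mulr0.
case/eqP: s_neq1; have {}zE (i : 'I_M) : z' (s i) = z i.
  by have /eqP <- := zE i; rewrite mnmE gez0_abs ?z'_ge0.
have s_mono (i j : 'I_M) : (i < j)%N -> (s i < s j)%N.
  move=> ij; rewrite ltnNge leq_eqVlt negb_or; apply/andP; split.
    by apply/eqP => /val_inj/perm_inj ji; rewrite ji ltnn in ij.
  apply/negP => sji; have := dec_z i j; rewrite ij ltn_ord => /(_ isT).
  rewrite -!zE; have := dec_z' (s j) (s i); rewrite sji ltn_ord => /(_ isT).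
  by move=> /lt_trans h /h; rewrite ltxx.
have s_ge k : forall i : 'I_M, nat_of_ord i = k -> (k <= s i)%N.
  elim: k => // k IH i iE; have kM : (k < M)%N by have := ltn_ord i; lia.
  apply: leq_ltn_trans (IH (Ordinal kM) erefl) _; apply: s_mono => /=; lia.
have s_le k : forall i : 'I_M, (nat_of_ord i + k.+1 = M)%N -> (s i <= i)%N.
  elim: k => [i iE|k IH i iE]; first by have := ltn_ord (s i); lia.
  have iM : (i.+1 < M)%N by lia.
  have /= := IH (Ordinal iM); rewrite addSnnS => /(_ iE).
  have /= := s_mono i (Ordinal iM) (leqnn _); lia.
apply/permP => i; rewrite perm1; apply/val_inj/eqP; rewrite eqn_leq.
apply/andP; split; last exact: s_ge.
by apply: (s_le (M - i.+1)%N); have := ltn_ord i; lia.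
Qed.

Lemma mcoeff_vandermonde M : (vandermonde M)@_[multinom (M - i.+1)%N | i < M] = 1.
Proof.
have := @mcoeff_zalternant_sorted M (fun i => (M - i.+1)%N%:Z) (fun i => (M - i.+1)%N%:Z).
rewrite -alternantE => ->; try by move=> *; lia.
by case: forallP => //; case=> i; exact/eqP.
Qed.

Lemma vandermonde_neq0 M : vandermonde M != 0.
Proof.
apply/eqP => d0; have := mcoeff_vandermonde M.
by rewrite d0 mcoeff0 => /eqP; rewrite eq_sym oner_eq0.
Qed.

Lemma mdeg_alternant M (k : nat -> nat) mu :
  (alternant A M k)@_mu != 0 -> mdeg mu = (\sum_(i < M) k i)%N.
Proof.
rewrite alternantE mcoeff_zalternant; apply: contra_neqP => mu_k.
apply: big1 => s _; case: forallP => [muE|_]; last by rewrite mulr0.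
case: mu_k; rewrite mdegE (reindex_inj (@perm_inj _ s)) /=.
by apply: eq_bigr => i _; have /eqP[] := muE i.
Qed.

Lemma msize_alternant M k : (msize (alternant A M k) <= (\sum_(i < M) k i).+1)%N.
Proof.
rewrite msizeE; apply/bigmax_leqP_seq => mu; rewrite mcoeff_msupp => nz _.
by rewrite (mdeg_alternant nz).
Qed.

Lemma msize_vandermonde M : msize (vandermonde M) = (\sum_(i < M) (M - i.+1)%N).+1.
Proof.
apply/eqP; rewrite eqn_leq msize_alternant /=.
have : [multinom (M - i.+1)%N | i < M] \in msupp (vandermonde M).
  by rewrite mcoeff_msupp mcoeff_vandermonde oner_eq0.
by move=> /msize_mdeg_lt; rewrite mdegE; under eq_bigr do rewrite mnmE.
Qed.

(** All variables are roots of the same monic polynomial prod_i (T - X_i), so the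
    remainder of T^k modulo it expresses every X_j^k with coefficients that do not
    depend on j. *)
Lemma expX_reduce M k :
  exists c : 'I_M -> {mpoly A[M]},
    forall j : 'I_M, 'X_j ^+ k = \sum_(l < M) c l * 'X_j ^+ l :> {mpoly A[M]}.
Proof.
pose P : {poly {mpoly A[M]}} := \prod_(i < M) ('X - ('X_i)%:P).
have P_monic : P \is monic by exact: monic_prod_XsubC.
have P_size : size P = M.+1.
  by rewrite size_prod_XsubC /index_enum -enumT size_enum_ord.
have RE := Pdiv.RingMonic.rdivp_eq P_monic 'X^k.
have Rlt : (size (Pdiv.CommonRing.rmodp 'X^k P) < M.+1)%N.
  by rewrite -P_size; apply: Pdiv.CommonRing.ltn_rmodpN0; exact: monic_neq0.
move: (Pdiv.CommonRing.rdivp _ _) (Pdiv.CommonRing.rmodp _ _) RE Rlt.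
move=> Q R RE Rsize; exists (fun l => R`_l) => j.
have P_root : P.['X_j] = 0.
  by rewrite /P (bigD1 j) // hornerM hornerXsubC subrr mul0r.
have := congr1 (horner^~ 'X_j) RE.
rewrite hornerXn hornerD hornerM P_root mulr0 add0r => ->.
exact: horner_coef_wide.
Qed.

(** The uniform reduction of powers factors the matrix of the alternant through
    the Vandermonde matrix. *)
Lemma vandermonde_dvd_alternant M k : exists q, q * vandermonde M = alternant A M k.
Proof.
have dvdV k' : exists q, alternant A M k' = q * alternant A M id.
  have [c cE] := choice (fun i : 'I_M => expX_reduce M (k' i)).
  exists (\det (\matrix_(i, l) c i l)); rewrite -det_mulmx; congr (\det _).
  apply/matrixP => i j; rewrite !mxE cE; apply: eq_bigr => l _.
  by rewrite !mxE.
have dE : vandermonde M = (-1) ^+ perm (@rev_ord_inj M) *: alternant A M id.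
  by apply: (@zalternant_perm M _ (fun i => i%:Z) 
    (fun i => (M - i.+1)%N%:Z)) => i; rewrite permE.
have [q ->] := dvdV k.
exists ((-1) ^+ perm (@rev_ord_inj M) *: q).
rewrite dE -scalerAl -scalerAr scalerA -exprD addnn -mul2n.
by rewrite exprM expr2 mulrNN mul1r expr1n scale1r.
Qed.

Lemma msym_alternant M k (s : 'S_M) :
  msym s (alternant A M k) = (-1) ^+ s *: alternant A M k.
Proof.
apply/mpolyP => mu; rewrite mcoeff_sym mcoeffZ alternantE !mcoeff_zalternant mulr_sumr.
rewrite (reindex_inj (@mulIg _ (s^-1)%g)); apply: eq_bigr => t _.
rewrite mulrA; congr (_ * _).
  by rewrite odd_permM odd_permV signr_addb mulrC.
congr (nat_of_bool _)%:R; apply: eq_forallb => i.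
by rewrite mnmE permM permKV.
Qed.

End Alternants.

(** * Existence of Schur functions *)

Section Schur.
Variable A : numDomainType.

Lemma kill_lastX n (j : 'I_n.+1) :
  kill_last ('X_j : {mpoly A[n.+1]}) =
    oapp (fun j : 'I_n => 'X_j) 0 (unlift ord_max j).
Proof. by rewrite /kill_last comp_mpolyXU -tnth_nth tnth_mktuple. Qed.

Lemma kill_lastM n (p q : {mpoly A[n.+1]}) :
  kill_last (p * q) = kill_last p * kill_last q.
Proof. by rewrite /kill_last rmorphM. Qed.

Lemma kill_lastXn n (p : {mpoly A[n.+1]}) k :
  kill_last (p ^+ k) = kill_last p ^+ k.
Proof. by rewrite /kill_last rmorphXn. Qed.

Lemma kill_last_alternant_gt0 n (k : nat -> nat) :
  (forall i, (i <= n)%N -> (0 < k i)%N) -> kill_last (alternant A n.+1 k) = 0.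
Proof.
move=> k_gt0; rewrite /alternant (expand_det_col _ ord_max) {1}/kill_last raddf_sum.
apply: big1 => i _; rewrite -[LHS]/(kill_last _) kill_lastM mxE.
rewrite kill_lastXn kill_lastX.
rewrite unlift_none /= expr0n; have := k_gt0 i; rewrite -ltnS ltn_ord.
by case: (k i) => [/(_ isT)//|?]; rewrite mul0r.
Qed.

(** At X_n = 0 the last column becomes a unit vector, and expanding along it
    leaves a smaller alternant in which every row has a spare power of the
    variables. *)
Lemma kill_last_alternant n (k : nat -> nat) :
  k n = 0%N -> (forall i, (i < n)%N -> (0 < k i)%N) ->
  kill_last (alternant A n.+1 k) =
    alternant A n (fun i => (k i).-1) * \prod_(j < n) 'X_j.
Proof.
move=> kn k_gt0; rewrite /kill_last /alternant -det_map_mx.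
rewrite (expand_det_col _ ord_max) (bigD1 ord_max) //= big1 ?addr0; last first.
  move=> i i_max; rewrite !mxE -[X in X * _]/(kill_last _) kill_lastXn kill_lastX.
  rewrite unlift_none /= expr0n; have := k_gt0 i.
  rewrite ltn_neqAle -ltnS ltn_ord andbT => /(_ i_max).
  by case: (k i) => // ?; rewrite mul0r.
rewrite !mxE kn expr0 rmorph1 mul1r /cofactor addnn -mul2n exprM sqrrN.
rewrite !expr1n mul1r.
transitivity (\det ((\matrix_(i < n, j < n) 'X_j ^+ (k i).-1) *m
   diag_mx (\row_(j < n) 'X_j) : 'M[{mpoly A[n]}]_n)).
  congr (\det _); apply/matrixP => i j; rewrite mul_mx_diag !mxE.
  rewrite -[LHS]/(kill_last _) kill_lastXn kill_lastX liftK /=.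
  rewrite -exprSr prednK ?k_gt0 //; congr (_ ^+ k _).
  exact: (lift_max i).
rewrite det_mulmx det_diag; congr (_ * _).
by apply: eq_bigr => i _; rewrite mxE.
Qed.

Lemma kill_last_vandermonde n :
  kill_last (vandermonde A n.+1) = vandermonde A n * \prod_(j < n) 'X_j.
Proof.
rewrite /vandermonde kill_last_alternant; last 2 first.
- exact: subnn.
- by move=> i i_n; lia.
apply: (congr1 (fun p => p * \prod_(j < n) 'X_j)).
by apply: eq_alternant => i i_n; lia.
Qed.

Lemma prodX_neq0 n : \prod_(j < n) 'X_j != 0 :> {mpoly A[n]}.
Proof.
rewrite -(mesymnnE n A); exact: mesym_neq0.
Qed.

(** In n variables the function is the quotient of alternants when n is at least
    the length l of la, and 0 otherwise.  The passage from l to l - 1 variables is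
    compatible with this choice because every exponent is then positive, so that
    setting the last variable to 0 annihilates the alternant. *)
Lemma schurP (la : nat -> nat) L : (forall i, (L <= i)%N -> la i = 0%N) ->
  forall n, (forall i, (n <= i)%N -> la i = 0%N) ->
  schur A la n * vandermonde A n = alternant A n (fun i => la i + (n - i.+1))%N.
Proof.
move=> laL; suff: exists f : symfun A, forall n,
    (forall i, (n <= i)%N -> la i = 0%N) ->
    f n * vandermonde A n = alternant A n (fun i => la i + (n - i.+1))%N.
  by rewrite /schur => /xgetPex /= /(_ 0).
have [l la_l la_min] : exists2 l, forall i, (l <= i)%N -> la i = 0%N &
    forall l', l = l'.+1 -> la l' != 0%N.
  elim: L laL => [|L IH] laL; first by exists 0%N.
  have [la0|la0] := eqVneq (la L) 0%N; last by exists L.+1 => // l' [<-].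
  apply: IH => i; rewrite leq_eqVlt => /predU1P[<- //|]; exact: laL.
have le_l n : (forall i, (n <= i)%N -> la i = 0%N) -> (l <= n)%N.
  case: l la_min {la_l} => // l' /(_ _ erefl) nz lan.
  by rewrite ltnNge; apply: contraNN nz => /lan ->.
pose f n : {mpoly A[n]} := if (l <= n)%N then
  xget 0 [set q | q * vandermonde A n = alternant A n (fun i => la i + (n - i.+1))%N]
  else 0.
have fE n : (l <= n)%N ->
    f n * vandermonde A n = alternant A n (fun i => la i + (n - i.+1))%N.
  move=> ln; rewrite /f ln.
  by have /xgetPex /= -> := vandermonde_dvd_alternant A n (fun i => la i + (n - i.+1))%N.
have f0 n : (n < l)%N -> f n = 0 by rewrite /f ltnNge => /negbTE ->.
have f_symfun : is_symfun f.
  split=> [n|n|].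
  - have [ln|/f0 ->] := leqP l n; last exact: rpred0.
    apply/issymP => s; apply: (mulIf (vandermonde_neq0 A n)).
    have sgnI (p q : {mpoly A[n]}) : (-1) ^+ s *: p = (-1) ^+ s *: q -> p = q.
      by case: (odd_perm s); rewrite ?scaleN1r ?scale1r // => /oppr_inj.
    apply: sgnI.
    by rewrite scalerAr -msym_alternant -msymM fE // msym_alternant.
  - have [l_n|] := leqP l n.
      apply: (mulIf (vandermonde_neq0 A n)); apply: (mulIf (prodX_neq0 n)).
      rewrite -[LHS]mulrA -kill_last_vandermonde -kill_lastM fE ?leqW // fE //.
      rewrite kill_last_alternant; last 2 first.
      + by rewrite subnn addn0 la_l.
      + by move=> i i_n; lia.
      apply: (congr1 (fun p => p * \prod_(j < n) 'X_j)).
      by apply: eq_alternant => i i_n; lia.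
    rewrite leq_eqVlt => /predU1P[nl|n_l]; last first.
      by rewrite !f0 // ?(ltnW n_l) // /kill_last raddf0.
    rewrite (f0 n) -?nl // ?ltnS //.
    apply: (mulIf (vandermonde_neq0 A n)); apply: (mulIf (prodX_neq0 n)).
    rewrite -mulrA -kill_last_vandermonde -kill_lastM fE ?nl // !mul0r.
    apply: kill_last_alternant_gt0 => i; rewrite leq_eqVlt.
    move=> /predU1P[->|]; last by lia.
    by have := la_min n; rewrite nl => /(_ erefl); case: (la n).
  exists (\sum_(0 <= i < l) la i).+1 => n.
  have [ln|/f0 ->] := leqP l n; last by rewrite msize0.
  have [->|nz] := eqVneq (f n) 0; first by rewrite msize0.
  have := msize_alternant A n (fun i => la i + (n - i.+1))%N.
  rewrite -fE // msizeM ?vandermonde_neq0 // msize_vandermonde big_split /= addnS /=.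
  rewrite -addSn leq_add2r => /leq_trans -> //.
  rewrite -(big_mkord xpredT la) (big_cat_nat (leq0n l) ln) /= [X in (_ + X)%N]big_nat_cond.
  by rewrite [X in (_ + X)%N]big1 ?addn0 // => i; rewrite andbT => /andP[/la_l].
by exists (SymFun f_symfun) => n /le_l /fE.
Qed.

End Schur.

(** * Linear extension and maya diagrams *)

Section FreeLift.
Variables (A : comNzRingType) (K : choiceType) (V : lmodType A) (F : K -> V).

Lemma fgliftD : {morph fglift F : D E / D + E}.
Proof.
have B := lift_is_additive F.
have f0 : fglift F 0 = 0 by rewrite -(subrr 0) B subrr.
have fN D : fglift F (- D) = - fglift F D by rewrite -sub0r B f0 sub0r.
by move=> D E; rewrite -{1}[E]opprK B fN opprK.
Qed.

Lemma fglift_sum (I : Type) (r : seq I) (P : pred I) (D : I -> {freeg K / A}) :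
  fglift F (\sum_(i <- r | P i) D i) = \sum_(i <- r | P i) fglift F (D i).
Proof.
apply: (big_morph _ fgliftD).
have B := lift_is_additive F; by rewrite -(subrr 0) B subrr.
Qed.

Lemma fglift0 : fglift F 0 = 0.
Proof. by have := fglift_sum [::] xpredT (fun _ : unit => 0); rewrite !big_nil. Qed.

Lemma fgliftE D : fglift F D = \sum_(x <- dom D) coeff x D *: F x.
Proof.
rewrite -[in LHS](freeg_sumE D) fglift_sum.
by apply: eq_bigr => x _; rewrite liftU.
Qed.

Lemma fgliftZ a : {morph fglift F : D / a *: D}.
Proof.
move=> D; have -> : a *: D = \sum_(x <- dom D) << a * coeff x D *g x >>.
  apply/eqP/freeg_eqP => y; rewrite coeffZ -[X in coeff y X](freeg_sumE D) !raddf_sum /=.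
  by rewrite mulr_sumr; apply: eq_bigr => x _; rewrite !coeffU mulrA.
rewrite fglift_sum fgliftE scaler_sumr.
by apply: eq_bigr => x _; rewrite liftU scalerA.
Qed.

Lemma fgliftU x : fglift F << x >> = F x.
Proof. by rewrite liftU scale1r. Qed.

End FreeLift.

Section MayaSeq.
Implicit Types (x : maya 0) (M : nat) (z : nat -> int).

(** In terms of partitions, a maya diagram with this property has at most M
    parts. *)
Definition vacuum_from M z := forall i, (M <= i)%N -> z i = - i.+1%:Z.

Lemma vacuum_fromW M M' z : (M <= M')%N -> vacuum_from M z -> vacuum_from M' z.
Proof. by move=> MM' vz i /(leq_trans MM') /vz. Qed.

Lemma maya_vacuum_from x : exists M, vacuum_from M x.
Proof. by case: (mayaP x) => _ [M xM]; exists M => i /xM ->; rewrite add0r. Qed.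

Lemma maya_dec x i j : (i < j)%N -> x j + (j - i)%N%:Z <= x i.
Proof.
case: (mayaP x) => dec_x _; elim: j => // j IH.
have := dec_x j; rewrite ltnS leq_eqVlt => + /predU1P[->|ij]; first by lia.
by have := IH ij; lia.
Qed.

Lemma maya_ge x i : - i.+1%:Z <= x i.
Proof.
have [M xM] := maya_vacuum_from x; have [/xM -> //|iM] := leqP M i.
by have := maya_dec x iM; rewrite xM //; lia.
Qed.

Lemma maya_eqP (x y : maya 0) : (forall i, x i = y i) -> x = y.
Proof.
case: x y => [u uP] [w wP] /= uw.
have {}uw : u = w by exact: functional_extensionality_dep.
by case: w / uw wP => wP; congr Maya; exact: Prop_irrelevance.
Qed.

(** Any strictly decreasing beginning above the vacuum level completes to a maya
    diagram. *)
Lemma maya_of_dec M z :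
  (forall i j, (i < j < M)%N -> z j < z i) ->
  (forall i, (i < M)%N -> - M%:Z <= z i) ->
  exists2 y : maya 0, vacuum_from M y & forall i, (i < M)%N -> y i = z i.
Proof.
move=> dec_z z_ge; pose w i := if (i < M)%N then z i else - i.+1%:Z.
have wP : is_maya 0 w.
  split=> [i|]; last by exists M => i; rewrite /w add0r ltnNge => ->.
  rewrite /w; case: (ltnP i.+1 M) => iM.
    by rewrite (ltnW iM) dec_z // ltnSn.
  by case: (ltnP i M) => [/z_ge|]; lia.
exists (Maya wP) => i /= iM; rewrite /w ?iM //.
by rewrite ltnNge iM.
Qed.

(** Stated for an arbitrary family, so that it sorts both the exponents of a
    monomial and the entries of a sequence. *)
Lemma sort_perm M (z : 'I_M -> int) :
  exists s : 'S_M, forall i j : 'I_M, (i < j)%N -> z (s j) <= z (s i).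
Proof.
pose t := [tuple z i | i < M].
have /tuple_permP[s sE] : perm_eq (sort (fun a b : int => b <= a) t) t.
  by rewrite perm_sort.
exists s => i j ij; pose r (a b : int) := b <= a.
have r_tr : transitive r by move=> a b c ba cb; exact: le_trans cb ba.
have srt : sorted r (sort r t) by apply: sort_sorted => a b; exact: le_total.
have szt : size (sort r t) = M by rewrite size_sort size_tuple.
have := sorted_ltn_nth r_tr 0 srt; rewrite szt.
move=> /(_ i j (ltn_ord _) (ltn_ord _) ij); rewrite /r sE.
by rewrite -!tnth_nth !tnth_mktuple.
Qed.

End MayaSeq.

(** * Schur functions as an orthonormal basis *)

Section SchurBasis.
Variable A : numDomainType.
Implicit Types (x y : maya 0) (f g : symfun A) (M : nat).

Definition raise M (z : nat -> int) i : int := z i + M%:Z.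

Lemma schur_maya_vandermonde x M : vacuum_from M x ->
  schur_maya A x M * vandermonde A M = zalternant A M (raise M x).
Proof.
move=> xM; have x0 i : (M <= i)%N -> maya_part x i = 0%N.
  by move=> /xM xi; rewrite /maya_part xi addNr.
rewrite /schur_maya (schurP A x0 x0) alternantE; apply: eq_zalternant => i iM.
by rewrite /raise /maya_part; have := maya_ge x i; lia.
Qed.

Definition raised_mnm M (z : nat -> int) : 'X_{1..M} :=
  [multinom `|raise M z i|%N | i < M].

(** When f is a combination of Schur functions, this is the coefficient of the
    Schur function of z, since s_z * a_delta has leading monomial
    raised_mnm M z. *)
Definition coef_in M (z : nat -> int) f : A := (f M * vandermonde A M)@_(raised_mnm M z).

Lemma raise_ge0 M x i : (i < M)%N -> 0 <= raise M x i.
Proof. by have := maya_ge x i; rewrite /raise; lia. Qed.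

(** Setting the last variable to 0 turns a_delta in M + 1 variables into a_delta
    in M variables times their product, which shifts all exponents by 1. *)
Lemma coef_in_stableS M x f : vacuum_from M x -> coef_in M.+1 x f = coef_in M x f.
Proof.
move=> xM; pose u := [multinom 1%N | i < M].
have uE : 'X_[u] = \prod_(j < M) 'X_j :> {mpoly A[M]}.
  by rewrite mpolyXE_id; apply: eq_bigr => i _; rewrite mnmE expr1.
have := congr1 (mcoeff (raised_mnm M x + u)) (kill_lastM (f M.+1) (vandermonde A M.+1)).
have [_ rf _] := symfunP f.
rewrite rf kill_last_vandermonde mulrA -uE addmC mcoeffMX mcoeff_kill_last => E.
rewrite [RHS]/coef_in -E /coef_in.
congr (_@__); apply/mnmP => i; rewrite mnmE.
case: (unliftP ord_max i) => [/= j|] ->; last first.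
  by rewrite mnmwiden_ordmax /raise xM // addNr.
rewrite -widen_lift mnmwiden_widen addmC mnmDE !mnmE /=.
by have := @raise_ge0 M x j (ltn_ord j); rewrite /raise; lia.
Qed.

Lemma coef_in_stable M M' x f : vacuum_from M x -> vacuum_from M' x ->
  coef_in M x f = coef_in M' x f.
Proof.
wlog MM' : M M' / (M <= M')%N => [H|] xM xM'.
  by have [/H|/ltnW/H h] := leqP M M'; [exact|apply/esym/h].
rewrite -(subnKC MM'); elim: (M' - M)%N => [|k IH]; first by rewrite addn0.
by rewrite addnS coef_in_stableS //; apply: vacuum_fromW xM; rewrite leq_addr.
Qed.

Definition schur_coef x f : A := coef_in (sval (cid (maya_vacuum_from x))) x f.

Lemma schur_coefE M x f : vacuum_from M x -> schur_coef x f = coef_in M x f.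
Proof. by move=> xM; apply: coef_in_stable => //; case: cid. Qed.

Lemma schur_coef_is_linear x a f g :
  schur_coef x (a *: f + g) = a * schur_coef x f + schur_coef x g.
Proof. by rewrite /schur_coef /coef_in /= mulrDl -scalerAl mcoeffD mcoeffZ. Qed.

Lemma schur_coefD x : {morph schur_coef x : f g / f + g}.
Proof. by move=> f g; rewrite -{1}[f]scale1r schur_coef_is_linear mul1r. Qed.
Lemma schur_coef0 x : schur_coef x 0 = 0.
Proof. by rewrite /schur_coef /coef_in /= mul0r mcoeff0. Qed.
Lemma schur_coefZ x a f : schur_coef x (a *: f) = a * schur_coef x f.
Proof. by rewrite -[a *: f]addr0 schur_coef_is_linear schur_coef0 addr0. Qed.
Lemma schur_coefN x f : schur_coef x (- f) = - schur_coef x f.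
Proof. by rewrite -scaleN1r schur_coefZ mulN1r. Qed.
Lemma schur_coef_sum x (I : Type) (r : seq I) (P : pred I) (F : I -> symfun A) :
  schur_coef x (\sum_(i <- r | P i) F i) = \sum_(i <- r | P i) schur_coef x (F i).
Proof. exact: (big_morph _ (schur_coefD x) (schur_coef0 x)). Qed.

Lemma raise_dec M x i j : (i < j)%N -> raise M x j < raise M x i.
Proof. by move=> ij; have := maya_dec x ij; rewrite /raise; lia. Qed.

Lemma schur_coef_schur x y : schur_coef x (schur_maya A y) = (x == y)%:R.
Proof.
have [[M1 xM] [M2 yM]] := (maya_vacuum_from x, maya_vacuum_from y).
pose M := maxn M1 M2.
have {}xM : vacuum_from M x by apply: vacuum_fromW xM; exact: leq_maxl.
have {}yM : vacuum_from M y by apply: vacuum_fromW yM; exact: leq_maxr.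
rewrite (schur_coefE _ xM) /coef_in schur_maya_vandermonde //.
rewrite mcoeff_zalternant_sorted; first last.
- by move=> i; exact: raise_ge0.
- by move=> i j /andP[ij _]; exact: raise_dec.
- by move=> i j /andP[ij _]; exact: raise_dec.
congr (nat_of_bool _)%:R; apply/forallP/eqP => [xy|-> //].
apply: maya_eqP => i; have [Mi|iM] := leqP M i; first by rewrite xM // yM.
by have /eqP := xy (Ordinal iM); rewrite /raise /=; lia.
Qed.

(** The product f * a_delta is alternating, hence determined by its coefficients
    at strictly decreasing exponents, and each of these comes from a maya
    diagram. *)
Lemma schur_coef_eq0 f : (forall x, schur_coef x f = 0) -> f = 0.
Proof.
move=> f0; apply: symfun_eqP => M /=.
suff: f M * vandermonde A M == 0.
  by rewrite mulf_eq0 (negbTE (vandermonde_neq0 A M)) orbF => /eqP.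
have [sf _ _] := symfunP f.
set g := f M * vandermonde A M.
have g_alt (s : 'S_M) (mu : 'X_{1..M}) :
    g@_[multinom mu (s i) | i < M] = (-1) ^+ s * g@_mu.
  rewrite -mcoeff_sym /g msymM (issymP _ (sf M)) /vandermonde msym_alternant.
  by rewrite -scalerAr mcoeffZ.
apply/eqP/mpolyP => mu; rewrite mcoeff0.
have [s sP] := sort_perm (fun i => (mu i)%:Z).
have [[i [j [ij muij]]]|mu_inj] :=
    pselect (exists i j : 'I_M, i != j /\ mu i = mu j).
  have := g_alt (tperm i j) mu; rewrite odd_tperm ij expr1 mulN1r.
  set nu := [multinom _ | _ < _]; have -> : nu = mu.
    by apply/mnmP => k; rewrite mnmE; case: tpermP => // ->.
  by move/eqP; rewrite -addr_eq0 -mulr2n mulrn_eq0 /= => /eqP.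
suff: g@_[multinom mu (s i) | i < M] = 0.
  by rewrite g_alt => /eqP; rewrite mulf_eq0 signr_eq0 => /eqP.
pose z i : int := (if insub i is Some j then (mu (s j))%:Z else 0) - M%:Z.
have zE (i : 'I_M) : z i = (mu (s i))%:Z - M%:Z by rewrite /z valK.
have [||y yM yz] := @maya_of_dec M z.
- move=> i j /andP[ij jM]; have iM := ltn_trans ij jM.
  rewrite (zE (Ordinal iM)) (zE (Ordinal jM)) ltrD2r lt_neqAle.
  rewrite (sP (Ordinal iM) (Ordinal jM)) // andbT; apply/eqP => -[mu_eq].
  apply: mu_inj; exists (s (Ordinal iM)), (s (Ordinal jM)); split=> //.
  by rewrite (inj_eq perm_inj); apply/eqP => -[ij']; rewrite ij' ltnn in ij.
- by move=> i iM; rewrite (zE (Ordinal iM)); lia.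
rewrite -(f0 y) (schur_coefE _ yM) /coef_in -/g; congr (_@__); apply/mnmP => i.
by rewrite !mnmE /raise yz // zE subrK.
Qed.

(** If the diagram of x has more than i rows then its weight exceeds i; comparing
    degrees therefore bounds the length of every partition that occurs in f. *)
Lemma schur_coef_vacuum_from d x f : (forall n, (msize (f n) <= d)%N) ->
  schur_coef x f != 0 -> vacuum_from d x.
Proof.
move=> fd xf; have [M0 xM0] := maya_vacuum_from x.
have {xM0} xM : vacuum_from (maxn M0 d) x by apply: vacuum_fromW xM0; exact: leq_maxl.
move: (maxn M0 d) xM (leq_maxr M0 d) => M xM dM.
move: xf; rewrite (schur_coefE _ xM) /coef_in -mcoeff_msupp => /msize_mdeg_lt.
have [->|nz] := eqVneq (f M) 0; first by rewrite mul0r msize0.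
rewrite msizeM ?vandermonde_neq0 // msize_vandermonde addnS /= mdegE.
have -> : (\sum_(i < M) raised_mnm M x i =
    \sum_(i < M) maya_part x i + \sum_(i < M) (M - i.+1))%N.
  rewrite -big_split /=; apply: eq_bigr => i _; rewrite mnmE.
  by rewrite /raise /maya_part; have := maya_ge x i; have := ltn_ord i; lia.
rewrite ltn_add2r => /leq_trans/(_ (fd M)) lt_d i di.
apply/eqP/contraT => xi; have [Mi|iM] := leqP M i; first by rewrite xM ?eqxx in xi.
have part_gt0 j : (j <= i)%N -> (0 < maya_part x j)%N.
  have := maya_ge x i; rewrite /maya_part => xi_ge.
  rewrite leq_eqVlt => /predU1P[->|/(maya_dec x)]; lia.
suff: (i < \sum_(i < M) maya_part x i)%N by lia.
rewrite -(big_mkord xpredT (maya_part x)) (big_cat_nat (leq0n i.+1) iM) /=.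
apply: leq_trans (leq_addr _ _); rewrite big_mkord.
apply: leq_trans (_ : \sum_(j < i.+1) 1 <= _)%N; first by rewrite sum1_card card_ord.
by apply: leq_sum => j _; apply: part_gt0; rewrite -ltnS.
Qed.

Lemma fock_to_symE (v : fock A 0) :
  fock_to_sym v = \sum_(x <- dom v) coeff x v *: schur_maya A x.
Proof. exact: fgliftE. Qed.

Lemma schur_coef_fock x (v : fock A 0) : schur_coef x (fock_to_sym v) = coeff x v.
Proof.
rewrite fock_to_symE schur_coef_sum -[in RHS](freeg_sumE v) raddf_sum /=.
by apply: eq_bigr => y _; rewrite schur_coefZ schur_coef_schur coeffU eq_sym.
Qed.

Lemma fock_to_sym_inj : injective (@fock_to_sym A).
Proof.
move=> u v uv; apply/eqP/freeg_eqP => x; by rewrite -!schur_coef_fock uv.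
Qed.

(** By the length bound, the coefficients of f are all visible in d variables, so
    only the finitely many monomials of f_d * a_delta can contribute. *)
Lemma fock_to_sym_surj f : exists v, fock_to_sym v = f.
Proof.
have [_ _ [d fd]] := symfunP f; pose g := f d * vandermonde A d.
have [||y0 _ _] := @maya_of_dec 0 (fun=> 0); first by move=> i j; rewrite ltn0 andbF.
  by move=> i.
pose my (mu : 'X_{1..d}) : maya 0 :=
  xget y0 [set y | vacuum_from d y /\ raised_mnm d y = mu].
have my_expo x : vacuum_from d x -> my (raised_mnm d x) = x.
  move=> xd; apply: xget_unique => [|y /= [yd yx]]; first by split.
  apply: maya_eqP => i; have [di|id] := leqP d i; first by rewrite xd // yd.
  have /(congr1 (fun mu : 'X_{1..d} => mu (Ordinal id))) := yx; rewrite !mnmE /=.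
  by have := raise_ge0 x id; have := raise_ge0 y id; rewrite /raise; lia.
pose X := undup [seq my mu | mu <- msupp g].
exists (\sum_(x <- X) schur_coef x f *: << x >>).
rewrite /fock_to_sym fglift_sum; apply/esym/eqP; rewrite -subr_eq0; apply/eqP.
apply: schur_coef_eq0 => x; rewrite schur_coefD schur_coefN schur_coef_sum.
under eq_bigr => y _ do rewrite fgliftZ fgliftU schur_coefZ schur_coef_schur.
have [xX|xX] := boolP (x \in X).
  rewrite (bigD1_seq x) ?undup_uniq //= eqxx mulr1 big1 ?addr0 ?subrr // => y yx.
  by rewrite eq_sym (negbTE yx) mulr0.
rewrite big_seq big1 ?subr0 => [|y yX]; last first.
  by case: eqVneq => [xy|]; rewrite ?mulr0 // xy yX in xX *.
apply/eqP/contraT => xf; have xd := schur_coef_vacuum_from fd xf.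
case/negP: xX; rewrite mem_undup -(my_expo x xd); apply: map_f.
by rewrite mcoeff_msupp; move: xf; rewrite (schur_coefE _ xd).
Qed.

(** The form is built by expanding its first argument in the Schur basis. *)
Lemma hallP : [/\ forall f, scalar (hall f), forall g, scalar ((@hall A)^~ g)
  & forall x y, hall (schur_maya A x) (schur_maya A y) = (x == y)%:R].
Proof.
pose inv f : fock A 0 := sval (cid (fock_to_sym_surj f)).
have invK f : fock_to_sym (inv f) = f by rewrite /inv; case: cid.
have invl a f g : inv (a *: f + g) = a *: inv f + inv g.
  by apply: fock_to_sym_inj; rewrite /fock_to_sym fgliftD fgliftZ
    -!/(fock_to_sym _) !invK.
have invs x : inv (schur_maya A x) = << x >>.
  by apply: fock_to_sym_inj; rewrite invK /fock_to_sym fgliftU.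
pose B f g : A := fglift (fun x => schur_coef x g : A^o) (inv f).
suff: exists B : symfun A -> symfun A -> A,
  [/\ forall f, scalar (B f), forall g, scalar (B^~ g)
    & forall x y, B (schur_maya A x) (schur_maya A y) = (x == y)%:R].
  by rewrite /hall => /xgetPex; apply.
exists B; split=> [f a g h|g a f h|x y].
- rewrite /B !fgliftE mulr_sumr -big_split /=; apply: eq_bigr => x _.
  by rewrite schur_coef_is_linear scalerDr /GRing.scale /= [_ * (a * _)]mulrCA.
- by rewrite /B invl fgliftD fgliftZ.
- by rewrite /B invs fgliftU schur_coef_schur.
Qed.

Lemma hallDl g : {morph (@hall A)^~ g : f h / f + h}.
Proof.
by move=> f h; have [_ H _] := hallP; have := H g 1 f h; rewrite scale1r mul1r.
Qed.
Lemma hall0l g : hall 0 g = 0 :> A.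
Proof.
by have /= := hallDl g 0 0; rewrite addr0 => /esym/eqP; rewrite -subr_eq0 addrK => /eqP.
Qed.
Lemma hallZl g a f : hall (a *: f) g = a * hall f g :> A.
Proof.
by have [_ H _] := hallP; have := H g a f 0; rewrite !addr0 hall0l addr0.
Qed.
Lemma hallDr f : {morph (@hall A) f : g h / g + h}.
Proof.
by move=> g h; have [H _ _] := hallP; have := H f 1 g h; rewrite scale1r mul1r.
Qed.
Lemma hall0r f : hall f 0 = 0 :> A.
Proof.
by have /= := hallDr f 0 0; rewrite addr0 => /esym/eqP; rewrite -subr_eq0 addrK => /eqP.
Qed.
Lemma hallZr f a g : hall f (a *: g) = a * hall f g :> A.
Proof.
by have [H _ _] := hallP; have := H f a g 0; rewrite !addr0 hall0r addr0.
Qed.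

Lemma hall_schurr f x : hall f (schur_maya A x) = schur_coef x f.
Proof.
have [v <-] := fock_to_sym_surj f; rewrite schur_coef_fock fock_to_symE.
rewrite (big_morph _ (hallDl _) (hall0l _)).
rewrite -[in RHS](freeg_sumE v) raddf_sum /=; apply: eq_bigr => y _.
by have [_ _ H] := hallP; rewrite hallZl H coeffU.
Qed.

Lemma hall_schurl f x : hall (schur_maya A x) f = schur_coef x f.
Proof.
have [v <-] := fock_to_sym_surj f; rewrite schur_coef_fock fock_to_symE.
rewrite (big_morph _ (hallDr _) (hall0r _)).
rewrite -[in RHS](freeg_sumE v) raddf_sum /=; apply: eq_bigr => y _.
by have [_ _ H] := hallP; rewrite hallZr H coeffU eq_sym.
Qed.

Lemma hall_inj f g : (forall h, hall f h = hall g h) -> f = g.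
Proof.
move=> fg; apply/eqP; rewrite -subr_eq0; apply/eqP/schur_coef_eq0 => x.
by rewrite schur_coefD schur_coefN -!hall_schurr fg subrr.
Qed.

End SchurBasis.

(** * Symmetric functions of sequences *)

Section Straighten.
Variable A : numDomainType.
Implicit Types (x z : nat -> int) (M n : nat).

Definition straightens c x (y : maya c) n (s : 'S_n) :=
  (forall i : 'I_n, x i = y (s i)) /\ (forall i, (n <= i)%N -> x i = y i).

(** A straightening permutation may be extended by fixed points without changing
    its sign, which makes different witnesses comparable. *)
Lemma straightens_widen c x (y : maya c) n (s : 'S_n) M :
  (n <= M)%N -> straightens x y s ->
  exists2 t : 'S_M, straightens x y t & (odd_perm t = odd_perm s).
Proof.
move=> nM xs; rewrite -(subnKC nM); elim: (M - n)%N => [|k [t [tl tr] ts]].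
  by rewrite addn0; exists s.
rewrite addnS; exists (lift_perm ord_max ord_max t); last first.
  by rewrite odd_lift_perm addbb.
split=> i; last by move=> ki; apply: tr; exact: ltnW.
case: (unliftP ord_max i) => [j|] ->.
  by rewrite lift_perm_lift !lift_max tl.
by rewrite lift_perm_id /= tr.
Qed.

Lemma straightens_large x (y : maya 0) n (s : 'S_n) :
  straightens x y s -> exists M0, forall M, (M0 <= M)%N ->
  fock_to_sym ((-1) ^+ s *: << y >> : fock A 0) M * vandermonde A M =
    zalternant A M (raise M x).
Proof.
move=> xs; have [N yN] := maya_vacuum_from y; exists (maxn n N) => M.
rewrite geq_max => /andP[nM NM]; have yM := vacuum_fromW NM yN.
have [t [tl _] <-] := straightens_widen nM xs.
rewrite /fock_to_sym fgliftZ fgliftU /= -scalerAl schur_maya_vandermonde //.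
by apply/esym/zalternant_perm => i; rewrite /raise tl.
Qed.

Lemma kill_last_zalternant M x : vacuum_from M x ->
  kill_last (zalternant A M.+1 (raise M.+1 x)) =
    zalternant A M (raise M x) * \prod_(j < M) 'X_j.
Proof.
move=> xM.
have [x_ge|] := pselect (forall i, (i < M)%N -> - M%:Z <= x i).
  have -> : zalternant A M.+1 (raise M.+1 x) =
      alternant A M.+1 (fun i => `|raise M.+1 x i|%N).
    rewrite alternantE; apply: eq_zalternant => i; rewrite ltnS leq_eqVlt.
    by move=> /predU1P[->|/x_ge]; rewrite /raise; [rewrite xM //|]; lia.
  rewrite kill_last_alternant; last 2 first.
  - by rewrite /raise xM // addNr.
  - by move=> i /x_ge; rewrite /raise; lia.
  apply: (congr1 (fun p => p * \prod_(j < M) 'X_j)).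
  by rewrite alternantE; apply: eq_zalternant => i /x_ge; rewrite /raise; lia.
move=> /existsNP[i /not_implyP[iM /negP]]; rewrite -ltNge => xi.
rewrite (zalternant_neg A iM) ?mul0r; last by rewrite /raise; lia.
suff -> : zalternant A M.+1 (raise M.+1 x) = 0 by rewrite /kill_last raddf0.
have [xi1|xi1] := eqVneq (x i) (- M.+1%:Z); last first.
  by apply: (@zalternant_neg A _ _ i); [exact: leqW|rewrite /raise; lia].
apply: (@zalternant_repeat A _ _ i M); rewrite ?ltnSn ?(ltnW iM) //; first by exact: leqW.
  by move=> iE; rewrite iE ltnn in iM.
by rewrite /raise xi1 xM.
Qed.

(** Compatibility of both sides under X_M = 0 lets an identity valid for many
    variables descend to every number of variables that covers the nonvacuum
    entries of x. *)
Lemma zalternant_descend (f : symfun A) x N : vacuum_from N x ->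
  (exists M0, forall M, (M0 <= M)%N ->
    f M * vandermonde A M = zalternant A M (raise M x)) ->
  f N * vandermonde A N = zalternant A N (raise N x).
Proof.
move=> xN [M0 fM]; have [_ rf _] := symfunP f.
suff: forall k,
    f (N + k)%N * vandermonde A (N + k) =
      zalternant A (N + k) (raise (N + k) x) ->
    f N * vandermonde A N = zalternant A N (raise N x).
  by move=> H; apply: (H M0); apply: fM; rewrite leq_addl.
elim=> [|k IH]; rewrite ?addn0 // addnS => fk; apply: IH.
have xNk : vacuum_from (N + k)%N x by apply: vacuum_fromW xN; rewrite leq_addr.
apply: (mulIf (prodX_neq0 A (N + k)%N)).
by rewrite -kill_last_zalternant // -fk kill_lastM rf kill_last_vandermonde mulrA.
Qed.

(** The Schur function of an arbitrary sequence, with the sign of its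
    straightening. *)
Definition wedge_sym x : symfun A := fock_to_sym (wedge A 0 x).

(** The bialternant formula for unsorted sequences.  It turns all sign rules for
    wedges into the corresponding rules for determinants. *)
Lemma wedge_sym_vandermonde x M : vacuum_from M x ->
  wedge_sym x M * vandermonde A M = zalternant A M (raise M x).
Proof.
move=> xM; rewrite /wedge_sym /wedge; case: xgetP => [v _ [y [n [s [xl xr ->]]]]|no_v].
  by apply: zalternant_descend => //; exact: straightens_large.
have [x_inj|] := pselect (injective x); last first.
  move=> /existsNP[p /existsNP[q /not_implyP[xpq pq]]].
  apply: zalternant_descend => //; exists (maxn p q).+1 => N.
  rewrite gtn_max => /andP[pN qN]; rewrite /fock_to_sym fglift0 mul0r.
  by rewrite (zalternant_repeat A pN qN pq) // /raise xpq.
have [s sP] := sort_perm (fun i : 'I_M => x i).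
pose z i : int := if insub i is Some j then x (s j) else 0.
have zE (i : 'I_M) : z i = x (s i) by rewrite /z valK.
have [||y yM yz] := @maya_of_dec M z.
- move=> i j /andP[ij jM]; have iM := ltn_trans ij jM.
  rewrite (zE (Ordinal iM)) (zE (Ordinal jM)) lt_neqAle.
  rewrite (sP (Ordinal iM) (Ordinal jM)) // andbT; apply/eqP.
  by move=> /x_inj/val_inj/perm_inj[ji]; rewrite ji ltnn in ij.
- move=> i iM; rewrite (zE (Ordinal iM)) leNgt; apply/negP.
  move: (s (Ordinal iM)) => a xa; have := ltn_ord a.
  suff <- : (`|x a|.-1)%N = nat_of_ord a by lia.
  by apply: x_inj; rewrite xM; lia.
case: (no_v ((-1) ^+ (s^-1)%g *: << y >>)); exists y, M, (s^-1)%g; split=> //.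
  by move=> i; rewrite yz // zE permKV.
by move=> i Mi; rewrite xM // yM.
Qed.

Lemma symfun_eq_large (f g : symfun A) M0 :
  (forall M, (M0 <= M)%N -> f M * vandermonde A M = g M * vandermonde A M) -> f = g.
Proof.
move=> fg; apply: symfun_eqP => n.
have [_ rf _] := symfunP f; have [_ rg _] := symfunP g.
suff: forall k, f (n + k)%N = g (n + k)%N -> f n = g n.
  move=> H; apply: (H M0); apply: (mulIf (vandermonde_neq0 A _)).
  by apply: fg; rewrite leq_addl.
elim=> [|k IH]; first by rewrite addn0.
by rewrite addnS => fk; apply: IH; rewrite -rf -rg fk.
Qed.

Lemma wedge_sym_repeat x M p q :
  vacuum_from M x -> p <> q -> x p = x q -> wedge_sym x = 0.
Proof.
move=> xM pq xpq; apply: (@symfun_eq_large _ _ (maxn M (maxn p q).+1)) => N.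
rewrite geq_max gtn_max => /and3P[MN pN qN]; rewrite mul0r wedge_sym_vandermonde.
  by rewrite (zalternant_repeat A pN qN pq) // /raise xpq.
exact: vacuum_fromW xM.
Qed.

Lemma wedge_sym_swap x z M p q : vacuum_from M x -> p <> q -> z p = x q -> z q = x p ->
  (forall i, i <> p -> i <> q -> z i = x i) -> wedge_sym z = - wedge_sym x.
Proof.
move=> xM pq zp zq zx; apply: (@symfun_eq_large _ _ (maxn M (maxn p q).+1)) => N.
rewrite geq_max gtn_max => /and3P[MN pN qN]; have xN := vacuum_fromW MN xM.
have zN : vacuum_from N z.
  by move=> i Ni; rewrite zx ?xN // => iE; move: pN qN Ni; rewrite -iE; lia.
rewrite [(- wedge_sym x) N]/= mulNr !wedge_sym_vandermonde //.
rewrite (@zalternant_perm A N (tperm (Ordinal pN) (Ordinal qN)) (raise N x)).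
  rewrite odd_tperm; have -> : Ordinal pN != Ordinal qN.
    by apply/eqP => -[].
  by rewrite scaleN1r.
move=> i; rewrite /raise; case: tpermP => [->|->|ip iq]; rewrite ?zp ?zq //=.
rewrite zx // => iE.
  by apply: ip; apply: val_inj.
by apply: iq; apply: val_inj.
Qed.

Lemma eq_wedge_sym x z : (forall i, x i = z i) -> wedge_sym x = wedge_sym z.
Proof. by move=> xz; congr wedge_sym; exact: functional_extensionality_dep. Qed.

Lemma fock_shift_wedge m z :
  fock_to_sym (fock_shift (wedge A m%:Z z)) = wedge_sym (fun i => z i - m%:Z).
Proof.
rewrite [in LHS]/wedge; case: xgetP => [v _ [y [n [s [zl zr ->]]]]|no_v].
  rewrite /fock_shift fgliftZ fgliftU.
  have zs : straightens (fun i => z i - m%:Z) (maya_shift y) s.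
    by split=> i => [|ni] /=; rewrite ?zl ?zr.
  have [M0 zM] := straightens_large zs.
  have [N yN] := maya_vacuum_from (maya_shift y).
  apply: (@symfun_eq_large _ _ (maxn M0 (maxn n N))) => M.
  rewrite !geq_max => /and3P[M0M nM NM]; rewrite zM // wedge_sym_vandermonde // => i Mi.
  by rewrite -(vacuum_fromW NM yN Mi) /= zr // (leq_trans nM).
rewrite /fock_shift fglift0 /wedge_sym /wedge; case: xgetP => [v _|_]; last first.
  by rewrite /fock_to_sym !fglift0.
move=> [y [n [s [zl zr _]]]].
have yP : is_maya m%:Z (fun i => y i + m%:Z).
  case: (mayaP y) => dec_y [N yN]; split=> [i|]; first by rewrite ltrD2r.
  by exists N => i /yN ->; lia.
case: (no_v ((-1) ^+ s *: << Maya yP >>)); exists (Maya yP), n, s; split=> //= i.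
  by rewrite -zl subrK.
by move=> ni; rewrite -zr // subrK.
Qed.

(** No cancellation happens when a wedge is shifted; this keeps the support of an
    infinite sum unchanged. *)
Lemma fock_shift_wedge_eq0 m z :
  wedge_sym (fun i => z i - m%:Z) = 0 -> wedge A m%:Z z = 0.
Proof.
rewrite -fock_shift_wedge => Wz0.
have /(@fock_to_sym_inj A) : fock_to_sym (fock_shift (wedge A m%:Z z)) =
    fock_to_sym (0 : fock A 0) by rewrite Wz0 /fock_to_sym fglift0.
rewrite /wedge; case: xgetP => [v _ [y [n [s [_ _ ->]]]]|//].
rewrite /fock_shift fgliftZ fgliftU.
move=> /(congr1 (coeff (maya_shift y))).
by rewrite coeffZ coeffU eqxx coeff0 !mulr1 => /eqP; rewrite signr_eq0.
Qed.

End Straighten.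

(** * Action of symmetric polynomials on sequences *)

Section MonomialLift.
Variables (A : numDomainType) (M : nat) (V : lmodType A).
Implicit Types (F G : 'X_{1..M} -> V) (p q : {mpoly A[M]}).

Definition mlift F p : V := fglift F (mpoly_val p).

Lemma mliftE F p : mlift F p = \sum_(mu <- msupp p) p@_mu *: F mu.
Proof. exact: fgliftE. Qed.

Lemma mliftD F : {morph mlift F : p q / p + q}.
Proof. by move=> p q; exact: fgliftD. Qed.

Lemma mlift0 F : mlift F 0 = 0.
Proof. by rewrite mliftE msupp0 big_nil. Qed.

Lemma mliftZ F a : {morph mlift F : p / a *: p}.
Proof. by move=> p; exact: fgliftZ. Qed.

Lemma mlift_sum F (I : Type) (r : seq I) (P : pred I) (p : I -> {mpoly A[M]}) :
  mlift F (\sum_(i <- r | P i) p i) = \sum_(i <- r | P i) mlift F (p i).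
Proof. exact: (big_morph _ (mliftD F) (mlift0 F)). Qed.

Lemma mliftX F mu : mlift F 'X_[mu] = F mu.
Proof. by rewrite mliftE msuppX big_seq1 mcoeffX eqxx scale1r. Qed.

Lemma eq_mlift F G p : (forall mu, F mu = G mu) -> mlift F p = mlift G p.
Proof. by move=> FG; rewrite !mliftE; apply: eq_bigr => mu _; rewrite FG. Qed.

Lemma mliftN F p : mlift (fun mu => - F mu) p = - mlift F p.
Proof. by rewrite !mliftE -sumrN; apply: eq_bigr => mu _; rewrite scalerN. Qed.

Lemma mlift_mulX F nu p :
  mlift F ('X_[nu] * p) = mlift (fun mu => F (nu + mu)%MM) p.
Proof.
rewrite [X in _ * X](mpolyE p) mulr_sumr mlift_sum [RHS]mliftE.
by apply: eq_bigr => mu _; rewrite -scalerAr -mpolyXD mliftZ mliftX.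
Qed.

Lemma mlift_msym F (s : 'S_M) p :
  mlift F (msym s p) = mlift (fun mu => F [multinom mu ((s^-1)%g i) | i < M]) p.
Proof.
rewrite [X in msym s X](mpolyE p) raddf_sum mlift_sum [RHS]mliftE.
by apply: eq_bigr => mu _; rewrite [X in mlift F X]/= msymZ msymX mliftZ mliftX.
Qed.

Lemma mlift_mpleth F m p :
  mlift F (mpleth m p) = mlift (fun mu => F (mu *+ m)%MM) p.
Proof.
rewrite mplethE mlift_sum mliftE.
by apply: eq_bigr => mu _; rewrite mliftZ mliftX.
Qed.

End MonomialLift.

Lemma mlift_morph (A : numDomainType) M (V V' : lmodType A) (L : V -> V')
    (F : 'X_{1..M} -> V) (p : {mpoly A[M]}) :
  {morph L : u v / u + v} -> L 0 = 0 -> (forall a, {morph L : u / a *: u}) ->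
  L (mlift F p) = mlift (fun mu => L (F mu)) p.
Proof.
move=> LD L0 LZ; rewrite !mliftE (big_morph L LD L0).
by apply: eq_bigr => mu _; rewrite LZ.
Qed.

Lemma mlift_mwiden (A : numDomainType) M (V : lmodType A)
    (F : 'X_{1..M.+1} -> V) (p : {mpoly A[M]}) :
  mlift F (mwiden p) = mlift (fun mu => F (mnmwiden mu)) p.
Proof.
rewrite [X in mwiden X](mpolyE p) raddf_sum mlift_sum [RHS]mliftE.
by apply: eq_bigr => mu _; rewrite [X in mlift F X]/= mwidenZ mwidenX mliftZ mliftX.
Qed.

Lemma mnmwiden_dec M (mu : 'X_{1..M.+1}) :
  mu ord_max = 0%N -> exists nu, mu = mnmwiden nu.
Proof.
move=> mu0; exists [multinom mu (widen_ord (leqnSn M) i) | i < M].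
apply/mnmP => i; case: (unliftP ord_max i) => [/= j|] -> /=.
  by rewrite -widen_lift mnmwiden_widen mnmE.
by rewrite mnmwiden_ordmax.
Qed.

(** If F vanishes on the monomials that involve the last variable, setting this
    variable to 0 loses nothing. *)
Lemma mlift_kill_last (A : numDomainType) M (V : lmodType A)
    (F : 'X_{1..M.+1} -> V) (p : {mpoly A[M.+1]}) :
  (forall mu : 'X_{1..M.+1}, mu ord_max != 0%N -> F mu = 0) ->
  mlift F p = mlift (fun mu => F (mnmwiden mu)) (kill_last p).
Proof.
move=> F0; rewrite mliftE [X in kill_last X](mpolyE p) /kill_last raddf_sum mlift_sum.
apply: eq_bigr => mu _; rewrite [X in mlift _ X]linearZ mliftZ; congr (_ *: _).
rewrite -[X in mlift _ X]/(kill_last 'X_[mu]).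
have [mu0|mu_n0] := eqVneq (mu ord_max) 0%N.
  have [nu muE] := mnmwiden_dec mu0; rewrite muE.
  have -> : kill_last 'X_[mnmwiden nu] = 'X_[nu] :> {mpoly A[M]}.
    apply/mpolyP => k; rewrite mcoeff_kill_last !mcoeffX.
    by rewrite inj_eq //; exact: inj_mnmwiden.
  by rewrite mliftX.
rewrite F0 // (_ : kill_last _ = 0) ?mlift0 //.
apply/mpolyP => k; rewrite mcoeff_kill_last mcoeffX mcoeff0.
case: eqVneq => // muk; case/eqP: mu_n0.
by rewrite muk mnmwiden_ordmax.
Qed.

Section Action.
Variable A : numDomainType.
Implicit Types (x y z : nat -> int) (M n : nat) (f g : symfun A).

(** The action of the monomial mu on z when the i-th variable moves the entry in
    position i by c; the operators of the plethysms are those with c = m and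
    c = - m. *)
Definition displace (c : int) z M (mu : 'X_{1..M}) : nat -> int :=
  fun i => z i + c * (nth 0%N mu i)%:Z.

Lemma displace_ord c z M (mu : 'X_{1..M}) (i : 'I_M) :
  displace c z mu i = z i + c * (mu i)%:Z.
Proof. by rewrite /displace -mnm_nth. Qed.

Lemma displace_ge c z M (mu : 'X_{1..M}) i : (M <= i)%N -> displace c z mu i = z i.
Proof. by move=> Mi; rewrite /displace nth_default ?size_tuple // mulr0 addr0. Qed.

Lemma vacuum_from_displace c z M N (mu : 'X_{1..M}) : (M <= N)%N ->
  vacuum_from N z -> vacuum_from N (displace c z mu).
Proof. by move=> MN zN i Ni; rewrite displace_ge ?zN //; exact: leq_trans Ni. Qed.

Lemma displace_mnmwiden c z M (mu : 'X_{1..M}) i :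
  displace c z (mnmwiden mu) i = displace c z mu i.
Proof.
rewrite /displace /mnmwiden /= nth_rcons size_tuple; case: ltnP => // Mi.
by rewrite if_same nth_default ?size_tuple.
Qed.

Lemma displace_mulm c z m M (mu : 'X_{1..M}) i :
  displace c z (mu *+ m)%MM i = displace (c * m%:Z) z mu i.
Proof.
have [Mi|iM] := leqP M i; first by rewrite !displace_ge.
rewrite (displace_ord c z _ (Ordinal iM)) (displace_ord _ z _ (Ordinal iM)) mulmnE.
by rewrite PoszM mulrA mulrAC.
Qed.

Lemma mul_zalternant M (p : {mpoly A[M]}) z : p \is symmetric ->
  (forall i, (i < M)%N -> 0 <= z i) ->
  p * zalternant A M z = mlift (fun mu => zalternant A M (displace 1 z mu)) p.
Proof.
move=> ps z_ge0; rewrite zalternant_sum_msym // mulr_sumr mliftE.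
pose k := [multinom `|z i|%N | i < M].
have iE (mu : 'X_{1..M}) : zalternant A M (displace 1 z mu) =
    \sum_(s : 'S_M) (-1) ^+ s *: msym s ('X_[mu] * 'X_[k]).
  rewrite zalternant_sum_msym => [|i iM]; last first.
    by rewrite (displace_ord _ _ _ (Ordinal iM)) mul1r /=; have := z_ge0 i iM; lia.
  apply: eq_bigr => s _; rewrite -mpolyXD; congr (_ *: msym s 'X_[_]).
  apply/mnmP => i; rewrite mnmDE !mnmE displace_ord mul1r.
  by have := z_ge0 i (ltn_ord i); lia.
under [RHS]eq_bigr => mu _ do rewrite iE scaler_sumr.
rewrite exchange_big /=; apply: eq_bigr => s _.
rewrite -scalerAr -[in LHS](issymP _ ps s) -msymM; under eq_bigr => mu _ do
  rewrite scalerA mulrC -scalerA.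
rewrite -scaler_sumr; congr (_ *: _).
rewrite [in LHS](mpolyE p) mulr_suml raddf_sum /=.
by apply: eq_bigr => mu _; rewrite -scalerAl msymZ.
Qed.

Lemma symfunME f g M : (f * g) M = f M * g M.
Proof. by []. Qed.

(** The bound on x excludes negative exponents, for which displacing and taking
    the alternant would not commute. *)
Lemma mul_wedge_sym f M x : vacuum_from M x -> (forall i, (i < M)%N -> - M%:Z <= x i) ->
  (f * wedge_sym A x) M * vandermonde A M =
    mlift (fun mu => wedge_sym A (displace 1 x mu)) (f M) M * vandermonde A M.
Proof.
move=> xM x_ge; have [sf _ _] := symfunP f.
rewrite (mlift_morph (L := fun g : symfun A => g M * vandermonde A M)); first last.
- by move=> a g /=; rewrite scalerAl.
- by rewrite mul0r.
- by move=> g h /=; rewrite mulrDl.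
rewrite symfunME -mulrA wedge_sym_vandermonde // mul_zalternant //; last first.
  by move=> i /x_ge; rewrite /raise; lia.
apply: eq_mlift => mu; rewrite wedge_sym_vandermonde; last exact: vacuum_from_displace.
by apply: eq_zalternant => i _; rewrite /displace /raise addrAC.
Qed.

Lemma eq_oppr_symfun f : f = - f -> f = 0.
Proof.
move=> fN; apply: schur_coef_eq0 => x; have := congr1 (schur_coef x) fN.
by rewrite schur_coefN => /eqP; rewrite -addr_eq0 -mulr2n mulrn_eq0 => /eqP.
Qed.

(** Exchanging the two positions with equal entries permutes the monomials of p
    and changes the sign of every wedge, so the sum is its own opposite. *)
Lemma mlift_wedge_sym_repeat M (p : {mpoly A[M]}) c z a b :
  p \is symmetric -> vacuum_from M z -> (a < M)%N -> (b < M)%N -> a <> b -> z a = z b ->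
  mlift (fun mu => wedge_sym A (displace c z mu)) p = 0.
Proof.
move=> ps zM aM bM ab zab; set G := fun mu => _; apply: eq_oppr_symfun.
rewrite -[in LHS](issymP _ ps (tperm (Ordinal aM) (Ordinal bM))) mlift_msym -mliftN.
apply: eq_mlift => mu; rewrite /G tpermV; set nu := [multinom _ | _ < _].
have nuE (i : 'I_M) : nu i = mu (tperm (Ordinal aM) (Ordinal bM) i).
  by rewrite mnmE.
apply: (@wedge_sym_swap A (displace c z mu) _ M a b) => //.
- exact: vacuum_from_displace.
- rewrite (displace_ord _ _ _ (Ordinal aM)) (displace_ord _ _ _ (Ordinal bM)) nuE tpermL.
  by rewrite /= zab.
- rewrite (displace_ord _ _ _ (Ordinal aM)) (displace_ord _ _ _ (Ordinal bM)) nuE tpermR.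
  by rewrite /= zab.
- move=> i ia ib; have [Mi|iM] := leqP M i; first by rewrite !displace_ge.
  rewrite !(displace_ord _ _ _ (Ordinal iM)) nuE tpermD //.
    by apply/eqP => -[] /esym.
  by apply/eqP => -[] /esym.
Qed.

(** Both sides are sums over a permutation s and a monomial mu: on the left the
    displaced y has to be sorted into x, on the right the lowered x into y.
    Inverting s and using the symmetry of f exchanges the two conditions. *)
Lemma schur_coef_mul_lower f (x y : maya 0) M : vacuum_from M x -> vacuum_from M y ->
  schur_coef x (f * schur_maya A y) =
    schur_coef y (mlift (fun mu => wedge_sym A (displace (-1) x mu)) (f M)).
Proof.
move=> xM yM; have [sf _ _] := symfunP f.
rewrite (schur_coefE _ xM) (schur_coefE _ yM) /coef_in symfunME -mulrA.
rewrite (schur_maya_vandermonde A yM) (mul_zalternant (sf M));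
  last by move=> i; exact: raise_ge0.
rewrite (mlift_morph (L := fun p => p@_(raised_mnm M x) : A^o)); first last.
- by move=> a p; rewrite mcoeffZ.
- exact: mcoeff0.
- exact: mcoeffD.
rewrite (mlift_morph (L := fun g : symfun A =>
    (g M * vandermonde A M)@_(raised_mnm M y) : A^o)).
- rewrite !mliftE.
  under eq_bigr => mu _ do rewrite mcoeff_zalternant scaler_sumr.
  rewrite exchange_big /=.
  have WE (mu : 'X_{1..M}) : wedge_sym A (displace (-1) x mu) M * vandermonde A M =
      zalternant A M (raise M (displace (-1) x mu)).
    by apply: wedge_sym_vandermonde; exact: vacuum_from_displace.
  under [RHS]eq_bigr => mu _ do rewrite WE mcoeff_zalternant scaler_sumr.
  rewrite [RHS]exchange_big /= [RHS](reindex_inj (@invg_inj _)) /=.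
  apply: eq_bigr => s _; rewrite odd_permV.
  pose G (mu : 'X_{1..M}) : A^o := (-1) ^+ s *
    [forall i, (raised_mnm M x (s i))%:Z == displace 1 (raise M y) mu i]%:R.
  transitivity (mlift G (f M)); first by rewrite mliftE.
  rewrite -[in LHS](issymP _ (sf M) (s^-1)%g) mlift_msym mliftE.
  apply: eq_bigr => mu _; apply: (congr1 (fun c : A => (f M)@_mu * c)); rewrite /G.
  congr (_ * (nat_of_bool _)%:R).
  rewrite invgK; apply/forallP/forallP => H i.
    have /eqP := H ((s^-1)%g i); rewrite permKV !displace_ord !mnmE permKV => xy.
    apply/eqP; rewrite [raise M (displace _ _ _) _]/raise displace_ord; move: xy.
    rewrite !gez0_abs ?raise_ge0 // /raise.
    by move: (x _) (y _) (Posz (mu _)) => a b c; lia.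
  have /eqP := H (s i); rewrite permK [raise M (displace _ _ _) _]/raise.
  rewrite !displace_ord !mnmE => xy.
  apply/eqP; move: xy; rewrite !gez0_abs ?raise_ge0 // /raise.
  by move: (x _) (y _) (Posz (mu _)) => a b c; lia.
- by move=> g h /=; rewrite mulrDl mcoeffD.
- by rewrite mul0r mcoeff0.
- by move=> a g /=; rewrite -scalerAl mcoeffZ.
Qed.

(** Lowering the last position L >= N by mu_L > 0 produces the vacuum entry of
    position L + mu_L, hence a repetition; a positive power of the last variable
    therefore acts by 0. *)
Lemma mlift_lower_stable f x N M : vacuum_from N x -> (N <= M)%N ->
  mlift (fun mu => wedge_sym A (displace (-1) x mu)) (f M) =
  mlift (fun mu => wedge_sym A (displace (-1) x mu)) (f N).
Proof.
move=> xN NM; have [_ rf _] := symfunP f.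
rewrite -(subnKC NM); elim: (M - N)%N => [|k IH]; first by rewrite addn0.
rewrite addnS -{}IH; have {xN} := vacuum_fromW (leq_addr k N) xN.
move: (N + k)%N => L xL; rewrite -(rf L) mlift_kill_last.
  by apply: eq_mlift => mu; apply: eq_wedge_sym => i; exact: displace_mnmwiden.
move=> mu mu_n0; apply: (@wedge_sym_repeat _ _ L.+1 L (L + mu ord_max)%N).
- by apply: vacuum_from_displace => //; apply: vacuum_fromW xL.
- by move: mu_n0; lia.
- rewrite (displace_ord _ _ _ (ord_max : 'I_L.+1)) displace_ge; last by move: mu_n0; lia.
  by rewrite !xL //=; [lia|rewrite leq_addr].
Qed.

Lemma hall_adjoint_schur (u g f : symfun A) :
  (forall y : maya 0, hall u (schur_maya A y) = hall g (f * schur_maya A y)) ->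
  forall h, hall u h = hall g (f * h).
Proof.
move=> ug h; have [v <-] := fock_to_sym_surj h; rewrite fock_to_symE.
rewrite mulr_sumr !(big_morph _ (hallDr _) (hall0r _)).
by apply: eq_bigr => y _; rewrite -scalerAr !hallZr ug.
Qed.

Lemma hall_lower f (x : maya 0) N h : vacuum_from N x ->
  hall (mlift (fun mu => wedge_sym A (displace (-1) x mu)) (f N)) h =
    hall (schur_maya A x) (f * h).
Proof.
move=> xN; move: h; apply: hall_adjoint_schur => y; rewrite hall_schurr hall_schurl.
have [M yM] := maya_vacuum_from y.
have xL : vacuum_from (maxn M N) x by apply: vacuum_fromW xN; exact: leq_maxr.
have yL : vacuum_from (maxn M N) y by apply: vacuum_fromW yM; exact: leq_maxl.
by rewrite (schur_coef_mul_lower f xL yL) -(mlift_lower_stable f xN (leq_maxr M N)).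
Qed.

(** The adjoint exists because it exists on each Schur function, by lowering
    operators. *)
Lemma hall_perp f g h : hall (perp f g) h = hall g (f * h) :> A.
Proof.
suff: exists D : symfun A -> symfun A, forall g h, hall (D g) h = hall g (f * h).
  by rewrite /perp => /xgetPex; apply.
suff /(@choice _ _) [D DP] : forall g, exists u : symfun A,
    forall h, hall u h = hall g (f * h) by exists D.
move=> {}g; have [v <-] := fock_to_sym_surj g.
have [N NP] := choice maya_vacuum_from.
exists (fglift (fun x : maya 0 =>
  mlift (fun mu => wedge_sym A (displace (-1) x mu)) (f (N x))) v) => {}h.
rewrite fock_to_symE fgliftE !(big_morph _ (hallDl _) (hall0l _)).
by apply: eq_bigr => x _; rewrite !hallZl hall_lower.
Qed.

Lemma perpP f u g : (forall h, hall u h = hall g (f * h)) -> perp f g = u.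
Proof. by move=> ug; apply: hall_inj => h; rewrite hall_perp ug. Qed.

Lemma perpD f : {morph perp f : g h / g + h}.
Proof. by move=> g h; apply: perpP => k; rewrite !hallDl !hall_perp. Qed.

Lemma perpZ f a : {morph perp f : g / a *: g}.
Proof. by move=> g; apply: perpP => k; rewrite !hallZl !hall_perp. Qed.

Lemma perp0 f : perp f 0 = 0.
Proof. by apply: perpP => k; rewrite !hall0l. Qed.

Lemma perp_schur f (x : maya 0) N : vacuum_from N x ->
  perp f (schur_maya A x) = mlift (fun mu => wedge_sym A (displace (-1) x mu)) (f N).
Proof. by move=> xN; apply: perpP => h; exact: hall_lower. Qed.

End Action.

(** * The alternating sum on a Schur function *)

Section Collapse.
Variable A : numDomainType.
Implicit Types (x z : nat -> int) (M N : nat).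

Lemma mcoeff_sf_h M (r : int) (mu : 'X_{1..M}) :
  (sf_h A r M)@_mu = ((mdeg mu)%:Z == r)%:R.
Proof. by case: r => k; [exact: mcoeff_mcomplete|exact: mcoeff0]. Qed.

Lemma mcoeffXM M (nu mu : 'X_{1..M}) (p : {mpoly A[M]}) :
  ('X_[nu] * p)@_mu = if (nu <= mu)%MM then p@_(mu - nu) else 0.
Proof.
case: ifPn => [le_nu|nle_nu].
  by rewrite -{1}(submK le_nu) addmC mulrC mcoeffMX.
rewrite (mpolyE p) mulr_sumr raddf_sum /= big1 // => k _.
rewrite -scalerAr -mpolyXD mcoeffZ mcoeffX; case: eqVneq => [E|]; last by rewrite mulr0.
by rewrite -E lem_addr in nle_nu.
Qed.

(** Split the monomials according to whether they involve the last variable. *)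
Lemma sf_h_recur M (r : int) :
  sf_h A r M.+1 = mwiden (sf_h A r M) + 'X_ord_max * sf_h A (r - 1) M.+1
    :> {mpoly A[M.+1]}.
Proof.
apply/mpolyP => mu; rewrite mcoeffD mcoeffXM !mcoeff_sf_h lep1mP.
have [mu0|mu_n0] := eqVneq (mu ord_max) 0%N.
  have [nu ->] := mnmwiden_dec mu0.
  by rewrite mwiden_mnmwiden mcoeff_sf_h mdeg_mnmwiden addr0.
have -> : (mwiden (sf_h A r M))@_mu = 0.
  rewrite (mwidenE (leqnn _)) raddf_sum /= big1 // => k _.
  rewrite mcoeffZ mcoeffX; case: eqVneq => [E|]; last by rewrite mulr0.
  by rewrite -E mnmwiden_ordmax in mu_n0.
rewrite add0r; congr (nat_of_bool _)%:R.
have : (U_(ord_max) <= mu)%MM by rewrite lep1mP.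
move=> /submK/(congr1 (@mdeg _)); rewrite mdegD mdeg1 => <-.
by apply/eqP/eqP; lia.
Qed.

(** Raising the vacuum entry in position L by m gives the vacuum entry of position
    L - m.  By the recursion, all monomials that involve the last variable are
    that raising followed by a symmetric polynomial, which kills a sequence with
    two equal entries. *)
Lemma mlift_h_stable x N m r M : vacuum_from N x -> (0 < m)%N -> (N + m <= M)%N ->
  mlift (fun mu => wedge_sym A (displace m%:Z x mu)) (sf_h A r M) =
  mlift (fun mu => wedge_sym A (displace m%:Z x mu)) (sf_h A r (N + m)%N).
Proof.
move=> xN m_gt0 NM; rewrite -(subnKC NM).
elim: (M - (N + m))%N => [|k IH]; first by rewrite addn0.
rewrite addnS -{}IH; have := leq_addr k (N + m); move: (N + m + k)%N => L NL.
rewrite sf_h_recur mliftD mlift_mwiden mlift_mulX [X in _ + X](_ : _ = 0) ?addr0.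
  by apply: eq_mlift => mu; apply: eq_wedge_sym => i; rewrite displace_mnmwiden.
pose z := displace m%:Z x (U_(ord_max) : 'X_{1..L.+1})%MM.
transitivity (mlift (fun mu => wedge_sym A (displace m%:Z z mu)) (sf_h A (r - 1) L.+1)).
  apply: eq_mlift => mu; apply: eq_wedge_sym => i; rewrite /z.
  have [Li|iL] := leqP L.+1 i; first by rewrite !displace_ge.
  by rewrite !(displace_ord _ _ _ (Ordinal iL)) mnmDE; lia.
have [sh _ _] := symfunP (sf_h A (r - 1)).
apply: (@mlift_wedge_sym_repeat _ _ _ _ _ (L - m)%N L) => //.
- by apply: vacuum_from_displace => //; apply: vacuum_fromW xN; lia.
- by lia.
- by lia.
rewrite /z (displace_ord _ _ _ (ord_max : 'I_L.+1)).
have Lm : (L - m < L.+1)%N by lia.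
rewrite (displace_ord _ _ _ (Ordinal Lm)) !mnm1E eqxx /=.
have -> : (ord_max == Ordinal Lm) = false by apply/eqP => -[]; lia.
by rewrite !xN; lia.
Qed.

Lemma mul_h_wedge_sym m (m_gt0 : (0 < m)%N) r x N : vacuum_from N x ->
  pleth_p m_gt0 (sf_h A r) * wedge_sym A x =
    mlift (fun mu => wedge_sym A (displace m%:Z x mu)) (sf_h A r (N + m)%N).
Proof.
move=> xN; pose M0 := (N + \sum_(i < N) `|x i|)%N.
apply: (@symfun_eq_large _ _ _ (maxn (N + m) M0)) => M.
rewrite geq_max => /andP[NM M0M].
rewrite -(mlift_h_stable r xN m_gt0 NM) mul_wedge_sym.
- congr (_ * _); rewrite [pleth_p _ _ _]/= mlift_mpleth.
  congr (symfun_val _ M); apply: eq_mlift => mu; apply: eq_wedge_sym => i.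
  by rewrite displace_mulm mul1r.
- by apply: vacuum_fromW xN; rewrite (leq_trans _ M0M) // leq_addr.
move=> i iM; have [Ni|iN] := leqP N i; first by rewrite xN //; lia.
have : (`|x i| <= \sum_(i < N) `|x i|)%N.
  by rewrite (bigD1 (Ordinal iN)) //= leq_addr.
by move: M0M; rewrite /M0; lia.
Qed.

Variables (m : nat) (m_gt0 : (0 < m)%N).

Lemma perp_e_schur i (x : maya 0) N : vacuum_from N x ->
  perp (pleth_p m_gt0 (sf_e A i)) (schur_maya A x) =
    \sum_(S : {set 'I_N} | #|S| == i) wedge_sym A (displace (- m%:Z) x (mesym1 S)).
Proof.
move=> xN; rewrite (perp_schur _ xN) [pleth_p _ _ _]/= mlift_mpleth mesymE mlift_sum.
apply: eq_bigr => S _; rewrite mliftX; apply: eq_wedge_sym => k.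
by rewrite displace_mulm mulN1r.
Qed.

(** Lowering the positions in S by m equals lowering all of the first N positions
    and then raising those outside S. *)
Definition complement_mnm N (S : {set 'I_N}) : 'X_{1..N + m} :=
  [multinom (if fintype.split i is inl j then (j \notin S : nat) else 0%N) | i < N + m].

Definition lowered x N : nat -> int := fun i => if (i < N)%N then x i - m%:Z else x i.

Lemma complement_mnm_lshift N (S : {set 'I_N}) j :
  complement_mnm S (lshift m j) = (j \notin S).
Proof. by rewrite mnmE (unsplitK (inl j)). Qed.

Lemma complement_mnm_rshift N (S : {set 'I_N}) j : complement_mnm S (rshift N j) = 0%N.
Proof. by rewrite mnmE (unsplitK (inr j)). Qed.

Lemma mdeg_complement_mnm N (S : {set 'I_N}) : (mdeg (complement_mnm S) + #|S|)%N = N.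
Proof.
rewrite mdegE big_split_ord /= [X in (_ + X + _)%N]big1 ?addn0 => [|j _]; last first.
  exact: complement_mnm_rshift.
under eq_bigr => j _ do rewrite complement_mnm_lshift.
rewrite -sum1_card (big_mkcond (fun j => j \in S)) -big_split /=.
rewrite (eq_bigr (fun=> 1%N)) ?sum1_card ?card_ord // => j _.
by case: (j \in S).
Qed.

Lemma displace_lowered x N (S : {set 'I_N}) (mu : 'X_{1..N + m}) i :
  displace m%:Z (displace (- m%:Z) x (mesym1 S)) mu i =
  displace m%:Z (lowered x N) (complement_mnm S + mu)%MM i.
Proof.
have [Mi|iM] := leqP (N + m) i.
  have Ni : (N <= i)%N by rewrite (leq_trans _ Mi) ?leq_addr.
  by rewrite !displace_ge // /lowered ltnNge Ni.
rewrite !(displace_ord _ _ _ (Ordinal iM)) mnmDE /=.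
case: (split_ordP (Ordinal iM)) => j iE.
  rewrite iE complement_mnm_lshift; have -> : i = j by have := congr1 val iE.
  rewrite displace_ord mnmE /lowered ltn_ord.
  by case: (j \in S) => /=; lia.
rewrite iE complement_mnm_rshift; have -> : i = (N + j)%N by have := congr1 val iE.
by rewrite displace_ge ?leq_addr // /lowered ltnNge leq_addr.
Qed.

Lemma natr_forall (I : finType) (P : pred I) :
  [forall i, P i]%:R = \prod_i (P i)%:R :> A.
Proof.
case: forallP => [allP|/existsNP[i /negP Pi]].
  by rewrite big1 // => i _; rewrite allP.
by rewrite (bigD1 i) //= (negbTE Pi) mul0r.
Qed.

(** The sum factors over the positions j < N as prod_j (-1 + [mu_j > 0]). *)
Lemma complement_mnm_sum N (mu : 'X_{1..N + m}) :
  \sum_(S : {set 'I_N}) (-1) ^+ #|S| * (complement_mnm S <= mu)%MM%:R =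
  (-1) ^+ N * [forall j : 'I_N, mu (lshift m j) == 0%N]%:R :> A.
Proof.
transitivity (\prod_(j < N) (-1 + (0 < mu (lshift m j))%N%:R) : A).
  rewrite bigA_distr; apply: eq_bigr => S _.
  have -> : (complement_mnm S <= mu)%MM =
      [forall j : 'I_N, (j \notin S <= mu (lshift m j))%N].
    apply/mnm_lepP/forallP => [le_mu j|le_mu i]; first by rewrite -complement_mnm_lshift.
    case: (split_ordP i) => j ->; first by rewrite complement_mnm_lshift.
    by rewrite complement_mnm_rshift.
  rewrite natr_forall -prodr_const big_mkcond -big_split /=.
  by apply: eq_bigr => j _; case: (j \in S); rewrite ?leq0n ?mulr1 ?mul1r.
rewrite natr_forall -[X in _ ^+ X]card_ord -prodr_const -big_split /=.
by apply: eq_bigr => j _; case: (mu _) => [|k]; rewrite ?addr0 ?mulr1 ?addNr ?mulr0.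
Qed.

(** The complete symmetric polynomial of degree r in the last m variables. *)
Definition tail_h N (r : int) : {mpoly A[N + m]} :=
  \sum_(mu <- msupp (sf_h A r (N + m)%N) | [forall j : 'I_N, mu (lshift m j) == 0%N])
    'X_[mu].

Lemma mcoeff_tail_h N r mu : (tail_h N r)@_mu =
  ((mdeg mu)%:Z == r)%:R * [forall j : 'I_N, mu (lshift m j) == 0%N]%:R.
Proof.
rewrite /tail_h raddf_sum /=; under eq_bigr do rewrite mcoeffX.
rewrite -mcoeff_sf_h.
have [mu_h|mu_h] := boolP (mu \in msupp (sf_h A r (N + m)%N)); last first.
  rewrite (memN_msupp_eq0 mu_h) mul0r big_seq_cond big1 // => k /andP[kh _].
  by case: eqVneq => // kmu; rewrite -kmu kh in mu_h.
rewrite big_mkcond (bigD1_seq mu) ?msupp_uniq //= eqxx big1 ?addr0 => [|k kmu].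
  move: mu_h; rewrite mcoeff_msupp mcoeff_sf_h.
  by case: (_ == r) => //=; rewrite ?eqxx // mul1r; case: ifP.
by rewrite (negbTE kmu); case: ifP.
Qed.

(** The identity sum_i (-1)^i e_(N-i)(Y) h_(n+i)(Y, Z) = (-1)^N h_(n+N)(Z), which
    replaces the cancellation of generating functions. *)
Lemma sum_complement_h N (n : int) :
  \sum_(S : {set 'I_N}) (-1) ^+ #|S| *:
     ('X_[complement_mnm S] * sf_h A (n + #|S|%:Z) (N + m)%N) =
  (-1) ^+ N *: tail_h N (n + N%:Z).
Proof.
apply/mpolyP => mu; rewrite raddf_sum mcoeffZ mcoeff_tail_h.
rewrite mulrCA -complement_mnm_sum mulr_sumr.
apply: eq_bigr => S _; rewrite [LHS]mcoeffZ mcoeffXM mcoeff_sf_h mulrCA.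
congr (_ * _).
case: ifPn => [le_mu|]; last by rewrite mulr0.
rewrite mulr1; congr (nat_of_bool _)%:R; have := mdeg_complement_mnm S.
have := congr1 (@mdeg _) (submK le_mu); rewrite mdegD => <- NE.
by apply/eqP/eqP; lia.
Qed.

(** After lowering all of the first N entries, the remaining raising operators are
    those of the previous identity. *)
Lemma sum_h_perp_e_schur n (x : maya 0) N K : vacuum_from N x -> (N < K)%N ->
  \sum_(i < K) (-1) ^+ i *: (pleth_p m_gt0 (sf_h A (n + i%:Z)) *
      perp (pleth_p m_gt0 (sf_e A i)) (schur_maya A x)) =
  (-1) ^+ N *:
    mlift (fun mu => wedge_sym A (displace m%:Z (lowered x N) mu)) (tail_h N (n + N%:Z)).
Proof.
move=> xN NK; rewrite -mliftZ -sum_complement_h mlift_sum.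
pose F (i : nat) S := (-1) ^+ i *:
  mlift (fun mu => wedge_sym A (displace m%:Z (lowered x N) mu))
    ('X_[complement_mnm S] * sf_h A (n + i%:Z) (N + m)%N) : symfun A.
transitivity (\sum_(i < K) \sum_(S : {set 'I_N} | #|S| == i) F i S).
  apply: eq_bigr => i _; rewrite (perp_e_schur _ xN) mulr_sumr scaler_sumr.
  apply: eq_bigr => S _; congr (_ *: _).
  rewrite (@mul_h_wedge_sym _ m_gt0 _ _ N); last exact: vacuum_from_displace.
  rewrite mlift_mulX; apply: eq_mlift => mu; apply: eq_wedge_sym => k.
  exact: displace_lowered.
rewrite (exchange_big_dep xpredT) //=; apply: eq_bigr => S _.
have SK : (#|S| < K)%N.
  by apply: leq_ltn_trans NK; rewrite -[X in (_ <= X)%N]card_ord max_card.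
rewrite (big_pred1 (Ordinal SK)) => [|i]; first by rewrite /F mliftZ.
by rewrite /= -val_eqE /= eq_sym.
Qed.

Lemma perp_e_schur0 i (x : maya 0) N : vacuum_from N x -> (N < i)%N ->
  perp (pleth_p m_gt0 (sf_e A i)) (schur_maya A x) = 0.
Proof.
move=> xN Ni; rewrite (perp_e_schur _ xN) big_pred0 // => S.
have : (#|S| <= N)%N by rewrite -[X in (_ <= X)%N]card_ord max_card.
by apply: contraTF => /eqP ->; rewrite -ltnNge.
Qed.

End Collapse.

(** * Moving the prepended entries into the vacuum *)

(** The two sums have the same support; when it is infinite, both are 0 by
    convention. *)
Lemma fsbig_inj_morph (V V' : zmodType) (I : choiceType) (D : set I)
    (F : I -> V) (L : V -> V') :
  {morph L : u v / u + v} -> L 0 = 0 ->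
  (forall i, D i -> L (F i) = 0 -> F i = 0) ->
  L (\sum_(i \in D) F i) = \sum_(i \in D) L (F i).
Proof.
move=> LD L0 Linj; rewrite (big_morph L LD L0) /finite_support.
suff -> : D `&` F @^-1` [set~ 0] = D `&` (fun i => L (F i)) @^-1` [set~ 0] by [].
apply/seteqP; split=> i [Di /= Fi]; split=> //= E; apply: Fi.
  exact: Linj.
by rewrite E.
Qed.

Section Rotation.
Variables (A : numDomainType) (m : nat) (m_gt0 : (0 < m)%N).
Implicit Types (x : nat -> int) (b : {ffun 'I_m -> int}) (N j : nat).

Definition slot b (i : nat) : int := if insub i is Some k then b k else 0.

Lemma slotE b (k : 'I_m) : slot b k = b k.
Proof. by rewrite /slot valK. Qed.

Lemma slot_ffun (e : nat -> int) i : (i < m)%N -> slot [ffun k : 'I_m => e k] i = e i.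
Proof. by move=> im; rewrite (slotE _ (Ordinal im)) ffunE. Qed.

Lemma sum_slot b : \sum_k b k = \sum_(0 <= i < m) slot b i.
Proof. by rewrite big_mkord; apply: eq_bigr => k _; rewrite slotE. Qed.

(** The sequence x lowered by m, with a block of m free entries inserted at
    position j.  The entries of the block are the vacuum entries of the positions
    they occupy, displaced by m times the entries of b. *)
Definition slot_seq x j b : nat -> int := fun i =>
  if (i < j)%N then x i - m%:Z
  else if (i < j + m)%N then - i.+1%:Z + m%:Z * slot b (i - j)
  else x (i - m)%N - m%:Z.

Lemma vacuum_from_slot_seq x N j b :
  vacuum_from N x -> (j <= N)%N -> vacuum_from (N + m) (slot_seq x j b).
Proof.
move=> xN jN i Ni; rewrite /slot_seq ifF; last by lia.
by rewrite ifF; last lia; rewrite xN; lia.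
Qed.

(** How the displacements of the block change when its first entry jumps over the
    block: the vacuum entry of its new position is lower by m, so its displacement
    grows by 1. *)
Definition rot b : {ffun 'I_m -> int} :=
  [ffun k : 'I_m => if (k.+1 < m)%N then slot b k.+1 else slot b 0 + 1].
Definition unrot b : {ffun 'I_m -> int} :=
  [ffun k : 'I_m => if nat_of_ord k == 0%N then slot b m.-1 - 1 else slot b k.-1].

Lemma slot_rot b i : (i < m)%N ->
  slot (rot b) i = if (i.+1 < m)%N then slot b i.+1 else slot b 0 + 1.
Proof.
exact: (slot_ffun (fun i => if (i.+1 < m)%N then slot b i.+1 else slot b 0 + 1)).
Qed.

Lemma slot_unrot b i : (i < m)%N ->
  slot (unrot b) i = if i == 0%N then slot b m.-1 - 1 else slot b i.-1.
Proof.
exact: (slot_ffun (fun i => if i == 0%N then slot b m.-1 - 1 else slot b i.-1)).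
Qed.

Lemma rotK : cancel rot unrot.
Proof.
move=> b; apply/ffunP => k; rewrite ffunE; have km := ltn_ord k.
case: posnP => [k0|k_gt0]; rewrite slot_rot; try lia.
  by rewrite prednK // ltnn addrK -(slotE b k) k0.
by rewrite prednK // km slotE.
Qed.

Lemma unrotK : cancel unrot rot.
Proof.
move=> b; apply/ffunP => k; rewrite ffunE; have := ltn_ord k.
case: ifP => [km _|km k_m]; first by rewrite slot_unrot //= slotE.
by rewrite slot_unrot //= subrK -(slotE b k); congr slot; lia.
Qed.

Lemma sum_rot b : \sum_k rot b k = \sum_k b k + 1.
Proof.
rewrite !sum_slot big_nat.
under eq_bigr => i /andP[_ im] do rewrite slot_rot //.
rewrite -big_nat -(prednK m_gt0) big_nat_recr //= ltnn big_nat_recl //=.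
rewrite addrA; congr (_ + 1); rewrite addrC; congr (_ + _).
by apply: eq_big_nat => i /andP[_ im]; rewrite ltnS im.
Qed.

(** Moving the block one step to the right amounts to the single transposition of
    positions j and j + m: the entry of x behind the block and the first entry of
    the block change places. *)
Lemma wedge_sym_rot x N j b : vacuum_from N x -> (j < N)%N ->
  wedge_sym A (slot_seq x j b) = - wedge_sym A (slot_seq x j.+1 (rot b)).
Proof.
move=> xN jN; apply: (@wedge_sym_swap A (slot_seq x j.+1 (rot b)) _ (N + m) j (j + m)).
- exact: vacuum_from_slot_seq.
- by lia.
- rewrite /slot_seq ltnn ifT ?subnn; last by lia.
  rewrite ifF; last by lia.
  rewrite ifT; last by lia.
  have -> : (j + m - j.+1 = m.-1)%N by lia.
  by rewrite slot_rot ?prednK ?ltnn //; lia.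
- rewrite /slot_seq ifF; last by lia.
  rewrite ifF; last by lia.
  by rewrite ltnSn addnK.
move=> i ij ijm; rewrite /slot_seq.
case: (ltnP i j) => ij'; first by rewrite ifT //; lia.
case: (ltnP i (j + m)) => ijm'.
  rewrite ifF; last by lia.
  rewrite ifT; last by lia.
  rewrite slot_rot; last by lia.
  rewrite ifT; last by lia.
  by congr (_ + _ * slot _ _); lia.
by rewrite ifF; [rewrite ifF //; lia|lia].
Qed.

Definition level (s : int) : set {ffun 'I_m -> int} := [set b | \sum_k b k = s].

Lemma rot_level s : set_bij (level s) (level (s + 1)) rot.
Proof.
split=> [b /= bs|b c _ _|b /= bs].
- by rewrite /level /= sum_rot bs.
- exact: (can_inj rotK).
- exists (unrot b); last exact: unrotK.
  by apply: (addIr 1); rewrite -sum_rot unrotK.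
Qed.

Definition slot_sum x j s : symfun A := \sum_(b \in level s) wedge_sym A (slot_seq x j b).

Lemma slot_sum_rot x N j s : vacuum_from N x -> (j < N)%N ->
  slot_sum x j s = - slot_sum x j.+1 (s + 1).
Proof.
move=> xN jN; rewrite /slot_sum [in RHS](reindex_fsbig _ _ _ _ (rot_level s)).
rewrite (fsbig_inj_morph (L := -%R)); first last.
- by move=> b _ /eqP; rewrite oppr_eq0 => /eqP.
- exact: oppr0.
- exact: opprD.
by apply: eq_fsbigr => b _; exact: wedge_sym_rot xN jN.
Qed.

Lemma slot_sum_rotN x N s : vacuum_from N x ->
  slot_sum x 0 s = (-1) ^+ N *: slot_sum x N (s + N%:Z).
Proof.
move=> xN; suff: forall j, (j <= N)%N ->
    slot_sum x 0 s = (-1) ^+ j *: slot_sum x j (s + j%:Z) by exact.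
elim=> [|j IH] jN; first by rewrite addr0 expr0 scale1r.
rewrite (IH (ltnW jN)) (slot_sum_rot _ xN jN) exprS mulN1r scaleNr scalerN.
by rewrite -addrA; congr (- (_ *: slot_sum _ _ (_ + _))); lia.
Qed.

(** The congruence conditions say exactly that each prepended entry differs from
    a vacuum entry by a multiple of m. *)
Lemma phi_slot_sum (x : maya 0) n :
  fock_to_sym (phi m (- n) << x >>) = slot_sum x 0 n.
Proof.
rewrite /phi fgliftU /slot_sum.
pose L (v : fock A m%:Z) := fock_to_sym (fock_shift v).
rewrite -[LHS]/(L _) (fsbig_inj_morph (L := L)); first last.
- by move=> a _; rewrite /L fock_shift_wedge => /fock_shift_wedge_eq0.
- by rewrite /L /fock_shift /fock_to_sym !fglift0.
- by move=> u v; rewrite /L /fock_shift /fock_to_sym !fgliftD.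
pose h b := [ffun k : 'I_m => k%:Z + m%:Z * b (rev_ord k)].
have m_neq0 : m%:Z != 0 by lia.
rewrite [LHS](reindex_fsbig h (level n)); last first.
  split=> [b /= b_n|b c _ _ bc|a /= [a_mod a_sum]].
  - split=> [i|]; first by rewrite ffunE mulrC addrC modzMDl.
    under eq_bigr do rewrite ffunE.
    rewrite big_split /= -mulr_sumr mulNr opprK mulrC; congr (_ + _ * _).
    by rewrite -b_n [RHS](reindex_inj rev_ord_inj).
  - apply/ffunP => k; have := congr1 (fun f : {ffun 'I_m -> int} => f (rev_ord k)) bc.
    rewrite !ffunE rev_ordK => /addrI; exact: mulfI.
  pose b := [ffun k : 'I_m => ((a (rev_ord k) - (rev_ord k)%:Z) %/ m%:Z)%Z].
  have ba k : a k = k%:Z + m%:Z * b (rev_ord k).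
    rewrite ffunE rev_ordK mulrC divzK ?subrKC // -eqz_mod_dvd.
    by apply/eqP; exact: a_mod.
  exists b; last by apply/ffunP => k; rewrite ffunE ba.
  apply: (mulfI m_neq0); move: a_sum; under eq_bigr => k _ do rewrite ba.
  rewrite big_split /= mulNr opprK => /addrI; rewrite -mulr_sumr [n * _]mulrC => <-.
  by rewrite [in LHS](reindex_inj rev_ord_inj).
apply: eq_fsbigr => b _; rewrite /L fock_shift_wedge; apply: eq_wedge_sym => i.
rewrite /prepend /slot_seq ltn0 add0n subn0.
case: insubP => [k km kE|]; last by rewrite -leqNgt => mi; rewrite ltnNge mi.
rewrite ffunE rev_ordK -kE ltn_ord slotE /=.
by have := ltn_ord k; lia.
Qed.

(** Once the block sits directly before the vacuum, a negative displacement hits a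
    vacuum entry. *)
Lemma slot_seq_neg x N b k :
  vacuum_from N x -> b k < 0 -> wedge_sym A (slot_seq x N b) = 0.
Proof.
move=> xN bk; pose q := (N + k + m * `|b k|)%N.
have mb : (m <= m * `|b k|)%N by rewrite leq_pmulr //; lia.
apply: (@wedge_sym_repeat _ _ (N + m) (N + k)%N q); first exact: vacuum_from_slot_seq.
  by rewrite /q; lia.
rewrite (vacuum_from_slot_seq b xN (leqnn N) (i := q)); last by rewrite /q; lia.
rewrite /slot_seq ifF; last by lia.
rewrite ifT ?ltn_add2l // addKn slotE /q.
have -> : b k = - `|b k|%N%:Z by lia.
by rewrite mulrN abszN absz_nat; lia.
Qed.

(** Only nonnegative displacements survive, and these are the exponents of the
    monomials of the complete symmetric polynomial in the last m variables. *)
Lemma slot_sum_tail x N s : vacuum_from N x ->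
  slot_sum x N s =
    mlift (fun mu => wedge_sym A (displace m%:Z (lowered m x N) mu))
      (tail_h A m N s).
Proof.
move=> xN; rewrite /tail_h mlift_sum; under [RHS]eq_bigr do rewrite mliftX.
rewrite -big_filter; set r := [seq mu <- _ | _].
have r_uniq : uniq r by rewrite filter_uniq // msupp_uniq.
have rE mu : (mu \in r) =
    ((mdeg mu)%:Z == s) && [forall j : 'I_N, mu (lshift m j) == 0%N].
  by rewrite mem_filter mcoeff_msupp mcoeff_sf_h pnatr_eq0 eqb0 negbK andbC.
pose g (mu : 'X_{1..N + m}) := [ffun k : 'I_m => (mu (rshift N k))%:Z].
have g_sum mu : mu \in r -> \sum_k g mu k = s.
  rewrite rE => /andP[/eqP <- /forallP mu0]; rewrite mdegE big_split_ord /=.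
  rewrite [X in (X + _)%N]big1 ?add0n => [|j _]; last exact/eqP/mu0.
  rewrite (big_morph Posz PoszD erefl).
  by apply: eq_bigr => k _; rewrite ffunE.
have g_W mu : mu \in r ->
    wedge_sym A (slot_seq x N (g mu)) =
      wedge_sym A (displace m%:Z (lowered m x N) mu).
  rewrite rE => /andP[_ /forallP mu0]; apply: eq_wedge_sym => i; rewrite /slot_seq.
  have [Mi|iM] := leqP (N + m) i.
    rewrite ifF; last by lia.
    rewrite displace_ge // /lowered ifF; last by lia.
    by rewrite !xN; lia.
  rewrite (displace_ord _ _ _ (Ordinal iM)) /lowered /=.
  case: (split_ordP (Ordinal iM)) => k iE; rewrite iE.
    have -> : i = k by have := congr1 val iE.
    by rewrite (eqP (mu0 k)) mulr0 addr0.
  have -> : i = (N + k)%N by have := congr1 val iE.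
  by rewrite addKn slotE ffunE xN ?leq_addr.
rewrite fsbig_seq //.
transitivity (\sum_(b \in g @` [set` r]) wedge_sym A (slot_seq x N b)).
  apply/esym/fsbig_widen => [b [mu /= mu_r <-]|b [/= bs b_r]]; first exact: g_sum.
  have [b_ge0|/existsNP[k /negP]] := pselect (forall k, 0 <= b k); last first.
    by rewrite -ltNge => bk; exact: slot_seq_neg bk.
  case: b_r.
  pose mu := [multinom (if fintype.split i is inr k then `|b k|%N else 0%N) | i < N + m].
  have muR k : mu (rshift N k) = `|b k|%N by rewrite mnmE (unsplitK (inr k)).
  have muL k : mu (lshift m k) = 0%N by rewrite mnmE (unsplitK (inl k)).
  exists mu; last by apply/ffunP => k; rewrite ffunE muR gez0_abs.
  rewrite /= rE; apply/andP; split; last by apply/forallP => k; rewrite muL.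
  rewrite mdegE big_split_ord /= [X in (X + _)%N]big1 ?add0n => [|k _]; last exact: muL.
  rewrite (big_morph Posz PoszD erefl) -bs; apply/eqP/eq_bigr => k _.
  by rewrite muR gez0_abs.
rewrite fsbig_image; first by apply: eq_fsbigr => mu; rewrite inE => /g_W.
move=> mu nu; rewrite !inE /= !rE => /andP[_ /forallP mu0] /andP[_ /forallP nu0] gg.
apply/mnmP => i; case: (split_ordP i) => k ->.
  by rewrite (eqP (mu0 k)) (eqP (nu0 k)).
by have := congr1 (fun f : {ffun 'I_m -> int} => f k) gg; rewrite !ffunE => -[].
Qed.

Definition vertex_term (n : int) (v : fock A 0) (i : nat) : symfun A :=
  (-1) ^+ i *: (pleth_p m_gt0 (sf_h A (n + i%:Z)) *
       perp (pleth_p m_gt0 (sf_e A i)) (fock_to_sym v)).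

Lemma phi_schur n (x : maya 0) : exists K0, forall K, (K0 <= K)%N ->
  vertex_term n << x >> K = 0 /\
  fock_to_sym (phi m (- n) << x >>) = \sum_(i < K) vertex_term n << x >> i.
Proof.
have [N xN] := maya_vacuum_from x; exists N.+1 => K NK.
have xE : fock_to_sym << x >> = schur_maya A x by exact: fgliftU.
rewrite /vertex_term xE; split.
  by rewrite (@perp_e_schur0 A m m_gt0 _ _ _ xN NK) mulr0 scaler0.
rewrite (@sum_h_perp_e_schur A m m_gt0 _ _ _ _ xN NK) phi_slot_sum.
by rewrite (slot_sum_rotN n xN) (slot_sum_tail (n + N%:Z) xN).
Qed.

(** A bound K0 beyond which all partial sums agree, rather than a single K, makes
    the property stable under linear combinations. *)
Lemma phi_sum_vertex_term n (v : fock A 0) : exists K0, forall K, (K0 <= K)%N ->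
  vertex_term n v K = 0 /\
  fock_to_sym (phi m (- n) v) = \sum_(i < K) vertex_term n v i.
Proof.
rewrite -[v]freeg_sumE; elim: (dom v) => [|x s [K1 IH]].
  exists 0%N => K _; rewrite !big_nil /vertex_term /phi /fock_to_sym !fglift0 !perp0.
  split; first by rewrite mulr0 scaler0.
  by rewrite big1 // => i _; rewrite perp0 mulr0 scaler0.
rewrite big_cons; have [K2 xP] := phi_schur n x; exists (maxn K1 K2) => K.
rewrite geq_max => /andP[/IH[b1 p1] /xP[b2 p2]].
have -> : << coeff x v *g x >> = coeff x v *: << x >> :> fock A 0.
  by apply/eqP/freeg_eqP => y; rewrite coeffZ !coeffU mul1r.
move: (\sum_(z <- s) _) b1 p1 => u b1 p1.
have bD i : vertex_term n (coeff x v *: << x >> + u) i =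
    coeff x v *: vertex_term n << x >> i + vertex_term n u i.
  rewrite /vertex_term /fock_to_sym fgliftD fgliftZ perpD perpZ.
  by rewrite mulrDr scalerDr -scalerAr !scalerA [_ * coeff x v]mulrC.
rewrite bD b1 b2 scaler0 addr0; split=> //.
under eq_bigr do rewrite bD.
rewrite big_split -scaler_sumr /= -p1 -p2.
by rewrite /phi /fock_to_sym !fgliftD !fgliftZ.
Qed.

End Rotation.

Theorem theorem3p1 (R : realType) (m : nat) (m_gt0 : (0 < m)%N) (n : int)
    (v : fock R[i] 0) :
  fock_to_sym (phi m (- n) v) =
    \sum_(i \in [set: nat]) (-1) ^+ i *:
      (pleth_p m_gt0 (sf_h R[i] (n + i%:Z)) *
       perp (pleth_p m_gt0 (sf_e R[i] i)) (fock_to_sym v)).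
Proof.
have [K vK] := @phi_sum_vertex_term R[i] m m_gt0 n v.
have [_ ->] := vK K (leqnn K); rewrite (fsbig_ord _ _ (vertex_term m_gt0 n v)).
apply: fsbig_widen => // i [_ /= iK]; apply: (vK i _).1.
by rewrite leqNgt; exact/negP.
Qed.
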